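(* Let $\mathbb G$ be a finite non-compact metric graph with vertices $V_1,\dots,V_N$, at most one non-compact edge being incident to each vertex. Assume that $\mathbb G$ is connected and that the lengths of its compact edges are rationally independent. Let $a_1,\dots,a_N\in\mathbb R$ be coupling constants, $a=(a_1,\dots,a_N)$, $\varkappa=\mathrm{diag}\{a_1,\dots,a_N\}$, and let $\widehat\Sigma_{\rm e}(s)$ be the scattering matrix of the pair formed by the Laplacian on $\mathbb G$ with $\delta$-type matching with coupling constants $a_1,\dots,a_N$ and the Laplacian on $\mathbb G$ with Kirchhoff matching (defined in the context). Let the vertices be numbered so that $V_1$ is an external vertex, $V_1\in\mathcal V^{({\rm e})}$. Fix a spanning tree $\mathbb T$ of the compact part $\mathbb G^{({\rm i})}$ of $\mathbb G$, rooted at $V_1$, the vertices being numbered so that the number of edges in the path $\gamma_m$ in $\mathbb T$ connecting $V_m$ and the root $V_1$ is a non-decreasing function of $m$. Then, the graph $\mathbb G$ (with its edge lengths) being known, given the scattering matrix $\widehat\Sigma_{\rm e}(s)$ for almost all $s>0$, the Robin-to-Dirichlet map for the set $\mathcal V^{({\rm e})}$ and the matrix of coupling constants $\varkappa$ are determined constructively in a unique way. Namely, the following formulae hold for $l=1,2,\dots,N$ and determine $a_m$, $m=1,\dots,N$: $$\sum_{m:\,V_m\in\gamma_l}a_m=\lim_{\tau\to+\infty}\Biggl\{-\tau\Bigl(\sum_{V_m\in\gamma_l}\deg(V_m)-2\bigl(N^{(l)}-1\bigr)\Bigr)-\frac{1}{f_1^{(l)}({\rm i}\tau)}\Biggr\},$$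 where $$f_1^{(l)}(\sqrt z):=\lim_{l^{(l)}_{N^{(l)}-1}\to0}\cdots\lim_{l^{(l)}_2\to0}\ \lim_{l^{(l)}_1\to0}f_1(\sqrt z),$$ and in the case $l=1$ no limits are taken in the last formula. Here $f_1$ is the $(1,1)$-entry of the Robin-to-Dirichlet map for $\mathcal V^{({\rm e})}$, $N^{(l)}$ is the number of vertices in the path $\gamma_l$, $l^{(l)}_1,\dots,l^{(l)}_{N^{(l)}-1}$ are the lengths of the edges of $\gamma_l$ ordered along the path from $V_1$ to $V_l$, and $\deg(V_m)$ is the degree of the vertex $V_m$, i.e. the number of elements (edge endpoints) in $V_m$.
   Context: **Metric graph.** A finite metric graph $\mathbb G$ is a finite non-empty collection of edges, each a compact interval $[0,l_j]$ or a half-line $[0,+\infty)$, together with a partition of the set of all (finite) endpoints into $N$ classes $V_1,\dots,V_N$ called vertices; loops and multiple edges are allowed. The degree is $\deg(V_m)=\mathrm{card}(V_m)$, the number of endpoints belonging to $V_m$. A vertex is external if a half-line is attached to it, internal otherwise; $\mathcal V^{({\rm e})}$ is the set of external vertices. The compact part $\mathbb G^{({\rm i})}$ is the graph $\mathbb G$ with all half-lines removed (with the same $N$ vertices). **Operators.** For $f$ in $W^{2,2}$ on every edge, $\partial_nf(x_j)$ is $f'(x_j)$ if $x_j$ is the left endpoint of the edge and $-f'(x_j)$ if it is the right endpoint. The $\delta$-type matching at $V_m$ with coupling constant $a_m$ is: $f$ is continuous at $V_m$ and $\sum_{x_j\in V_m}\partial_nf(x_j)=a_mf(V_m)$; Kirchhoff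 matching is the case $a_m=0$. The quantum graph Laplacian is $-d^2/dx^2$ in $L^2(\mathbb G)$ on the functions that are in $W^{2,2}$ of each edge and satisfy the $\delta$-type matching at all vertices. **Weyl matrices.** With $\operatorname{Im}\sqrt z\ge0$, $M^{({\rm i})}(z)$ is the $N\times N$ matrix with entries $$m_{kk}(z)=-\sqrt z\Bigl(\sum_{e_p\in E_k}\cot(\sqrt z\,l_p)-2\sum_{e_p\in L_k}\tan\tfrac{\sqrt z\,l_p}{2}\Bigr),\qquad m_{jk}(z)=\sqrt z\sum_{e_p\in C_{jk}}\frac1{\sin(\sqrt z\,l_p)}\quad(j\ne k),$$ where $l_p$ is the length of the edge $e_p$, $E_k$ is the set of non-loop compact edges incident to $V_k$, $L_k$ the set of loops at $V_k$, $C_{jk}$ the set of compact edges connecting $V_j$ and $V_k$ (an empty sum is $0$). $P_{\rm e}$ is the diagonal projection in $\mathbb C^N$ onto the coordinates of external vertices, and $M(z)=M^{({\rm i})}(z)+{\rm i}\sqrt z\,P_{\rm e}$. For $s>0$, $M(s)$ denotes the boundary value from $\mathbb C_+$ (with $\sqrt s>0$). **Scattering matrix.** For almost all $s>0$, $$\widehat\Sigma_{\rm e}(s)=P_{\rm e}(M(s)-\varkappa)^{-1}(M(s)^*-\varkappa)(M(s)^* )^{-1}M(s)P_{\rm e},$$ regarded as an operator in $P_{\rm e}\mathbb C^N$. **Robin-to-Dirichlet map for $\mathcal V^{({\rm e})}$.** For $z\in\mathbb C$ outside a countable set, consider functions $u$ on $\mathbb G^{({\rm i})}$ with $-u''=zu$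 on each edge, continuous at all vertices and satisfying the $\delta$-type matching (with constants $a_m$) at all internal vertices. The map sends the vector $\bigl\{\sum_{x_j\in V_m}\partial_nu(x_j)-a_mu(V_m)\bigr\}_{V_m\in\mathcal V^{({\rm e})}}$ to $\{u(V_m)\}_{V_m\in\mathcal V^{({\rm e})}}$. It is given by the matrix $P_{\rm e}(M^{({\rm i})}(z)-\varkappa)^{-1}P_{\rm e}$; in particular $f_1(\sqrt z)=\bigl((M^{({\rm i})}(z)-\varkappa)^{-1}\bigr)_{11}$. **Limits in edge lengths.** The entry $f_1$ is regarded as an explicit function of $\sqrt z$ and of all the compact edge lengths, given by the displayed formula for $M^{({\rm i})}$ with $a$ fixed; the limits in the definition of $f_1^{(l)}$ are limits of this function as the indicated edge lengths tend to $0$, taken successively, the innermost first.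
   Formalization: In the limit formula deg(V_m) is taken in the compact part (half-line ends not counted), as otherwise the expression diverges because V_1 is external; f_1 and its limits may take the value infinity, with 1/infinity = 0. *)

(* Defs.v *)
From HB Require Import structures.
From mathcomp Require Import all_boot all_order all_algebra.
From mathcomp Require Import all_classical all_reals all_analysis.
From mathcomp Require Import complex.

Set Implicit Arguments.
Unset Strict Implicit.
Unset Printing Implicit Defensive.

Import Order.TTheory GRing.Theory Num.Theory.
Import numFieldNormedType.Exports.

#[global] Open Scope ring_scope.
#[global] Open Scope classical_set_scope.
#[global] Open Scope complex_scope.
#[global] Open Scope sesquilinear_scope.

(** * Graphs *)

(* The combinatorial data of a finite metric graph with N vertices.  The
   partition of the endpoints into vertices is the map sending an endpoint to
   the index of its class: [cend e false] is the class of the left endpoint 0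
   of the compact edge e, [cend e true] that of its right endpoint, and
   [hend h] that of the endpoint of the half-line h.  Edge lengths are kept
   apart, because they are varied with the combinatorial structure fixed. *)
Record graph (N : nat) := Graph {
  cedge : finType;
  hline : finType;
  cend : cedge -> bool -> 'I_N;
  hend : hline -> 'I_N
}.

Section Graphs.
Context {N : nat}.
Implicit Types (G : graph N) (u v m : 'I_N).

Definition deg G m : nat :=
  (#|[set x : cedge G * bool | cend x.1 x.2 == m]|
   + #|[set h : hline G | hend h == m]|)%N.

(* The classes of a partition are non-empty; for N > 0 this also makes the
   collection of edges non-empty. *)
Definition nonempty_vertices G := forall m, (0 < deg G m)%N.

Definition external G m : bool := [exists h : hline G, hend h == m].

Definition compact_part G : graph N :=
  @Graph N (cedge G) void (@cend N G) (fun h : void => match h with end).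

(* An oriented edge (e, b) is e traversed starting from its endpoint b. *)
Definition otail G (d : cedge G * bool) : 'I_N := cend d.1 d.2.
Definition ohead G (d : cedge G * bool) : 'I_N := cend d.1 (~~ d.2).

Fixpoint walk G u (p : seq (cedge G * bool)) v : bool :=
  if p is d :: p' then (otail d == u) && walk (ohead d) p' v else u == v.

Definition walk_edges G (p : seq (cedge G * bool)) : seq (cedge G) :=
  [seq d.1 | d <- p].

Definition walk_vertices G u (p : seq (cedge G * bool)) : seq 'I_N :=
  u :: [seq ohead d | d <- p].

(* Half-lines end at a single vertex, so they play no role in connectedness. *)
Definition connected_graph G := forall u v, exists p, @walk G u p v.

Definition walk_in G (T : {set cedge G}) u p v :=
  walk u p v /\ {subset walk_edges p <= T}.

(* A connected set of edges covering all vertices, with no closed walk along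
   pairwise distinct edges (this excludes loops and multiple edges too). *)
Definition spanning_tree G (T : {set cedge G}) :=
  (forall u v, exists p, walk_in T u p v) /\
  (forall u p, walk_in T u p u -> uniq (walk_edges p) -> p = [::]).

Definition simple_path_in G (T : {set cedge G}) u p v :=
  walk_in T u p v /\ uniq (walk_vertices u p).

End Graphs.

Definition rationally_independent (R : realType) (I : finType) (x : I -> R) :=
  forall q : I -> rat, \sum_i ratr (q i) * x i = 0 -> forall i, q i = 0.

(** * Complex elementary functions *)

Section Elementary.
Context {R : realType}.
Implicit Types z : R[i].

Definition cexp z : R[i] :=
  (expR (complex.Re z))%:C * (cos (complex.Im z) +i* sin (complex.Im z)).
Definition csin z : R[i] := (cexp ('i * z) - cexp (- ('i * z))) / (2 * 'i).
Definition ccos z : R[i] := (cexp ('i * z) + cexp (- ('i * z))) / 2.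
Definition ctan z : R[i] := csin z / ccos z.
Definition ccot z : R[i] := ccos z / csin z.

End Elementary.

(** * Weyl matrices and the scattering matrix *)

Section Operators.
Context {R : realType} {N : nat}.
Variable G : graph N.
Implicit Types (len : cedge G -> R) (k z : R[i]) (a : 'rV[R]_N).
Implicit Types (s tau : R) (i j : 'I_N) (e : cedge G).

Definition is_loop e : bool := cend e false == cend e true.
Definition loop_at i e : bool := is_loop e && (cend e false == i).
Definition nonloop_at i e : bool :=
  ~~ is_loop e && ((cend e false == i) || (cend e true == i)).
Definition connects i j e : bool :=
  ((cend e false == i) && (cend e true == j))
  || ((cend e false == j) && (cend e true == i)).

(* The matrix M^(i) as a function of k = sqrt z and of the edge lengths. *)
Definition Weyl_int len k : 'M[R[i]]_N :=
  \matrix_(i, j)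
    if i == j then
      - k * (\sum_(e | nonloop_at i e) ccot (k * (len e)%:C)
             - 2 * \sum_(e | loop_at i e) ctan (k * (len e)%:C / 2))
    else k * \sum_(e | connects i j e) (csin (k * (len e)%:C))^-1.

Definition kappa a : 'M[R[i]]_N := diag_mx (map_mx (real_complex R) a).

Definition P_ext : 'M[R[i]]_N := diag_mx (\row_j (external G j)%:R).

(* [sqrtC] is the branch of the square root with 'Im (sqrtC z) >= 0 that is
   positive on s > 0; it is continuous up to s > 0 from the upper half-plane,
   so [Weyl len s%:C] is the boundary value M(s). *)
Definition Weyl len z : 'M[R[i]]_N :=
  Weyl_int len (sqrtC z) + ('i * sqrtC z) *: P_ext.

Definition scattering len a s : 'M[R[i]]_N :=
  let M := Weyl len s%:C in
  P_ext *m invmx (M - kappa a) *m (M ^t* - kappa a) *m invmx (M ^t*)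
    *m M *m P_ext.

(** * The Robin-to-Dirichlet map for the external vertices *)

(* -u'' = z u on the interval [0, l], where du stands for u': both functions
   are continuous on the closed interval, and differentiable inside it.  The
   derivative of a complex-valued function is taken componentwise. *)
Definition edge_solution z (l : R) (u du : R -> R[i]) :=
  forall part : R[i] -> R,
    part = @complex.Re R \/ part = @complex.Im R ->
    [/\ {within `[0, l], continuous (part \o u)},
        {within `[0, l], continuous (part \o du)} &
        forall x : R, 0 < x < l ->
          is_derive x (1 : R) (part \o u) (part (du x)) /\
          is_derive x (1 : R) (part \o du) (part (- (z * u x)))].

(* The endpoint (e, b) of the edge e has coordinate 0 if b is false and len e
   if b is true. *)
Definition endpoint len (x : cedge G * bool) : R :=
  if x.2 then len x.1 else 0.

Definition normal_derivative len (du : cedge G -> R -> R[i])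
    (x : cedge G * bool) : R[i] :=
  (-1) ^+ x.2 * du x.1 (endpoint len x).

(* phi is sent to psi.  Both are vectors of P_ext C^N, represented in C^N with
   zero entries at the internal vertices; thus the vanishing of phi there makes
   the equation for it the delta-type matching.  U is the vector of the values
   of u at all vertices.  For exceptional z this is only a relation. *)
Definition Robin_to_Dirichlet len a z (phi psi : 'cV[R[i]]_N) :=
  exists (u du : cedge G -> R -> R[i]) (U : 'cV[R[i]]_N),
    [/\ forall e, edge_solution z (len e) (u e) (du e),
        forall x : cedge G * bool,
          u x.1 (endpoint len x) = U (cend x.1 x.2) ord0,
        forall m, \sum_(x : cedge G * bool | cend x.1 x.2 == m)
                    normal_derivative len du x
                  - (a ord0 m)%:C * U m ord0 = phi m ord0,
        P_ext *m phi = phi &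
        psi = P_ext *m U].

Definition Robin_to_Dirichlet_mx len a z : 'M[R[i]]_N :=
  P_ext *m invmx (Weyl_int len (sqrtC z) - kappa a) *m P_ext.

(* z is outside the set where the matrix formula for the map is undefined. *)
Definition regular_point len a z :=
  (forall e, csin (sqrtC z * (len e)%:C) != 0) /\
  Weyl_int len (sqrtC z) - kappa a \in unitmx.

End Operators.

(** * Limits in edge lengths *)

(* Values of meromorphic functions: [None] is the point at infinity.  Infinite
   values cannot be avoided: if the compact part is a path whose coupling
   constants add up to 0, the function f_1^(N) is identically infinite. *)
Notation Riemann_sphere R := (one_point_compactification (complex R)^o).

(* 1 / w, with 1 / oo = 0; not to be used at w = 0. *)
Definition sphere_inv (R : realType) (w : Riemann_sphere R) : R[i] :=
  if w is Some x then x^-1 else 0.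

Section Limits.
Context {R : realType} {n : nat}.
Variable G : graph n.+1.
Implicit Types (len : cedge G -> R) (k : R[i]) (a : 'rV[R]_n.+1).

(* The entry f_1 as a function of k = sqrt z and of the edge lengths; the
   vertex V_1 is [ord0]. *)
Definition f1 a k len : Riemann_sphere R :=
  let A := Weyl_int len k - kappa a in
  if A \in unitmx then Some (invmx A ord0 ord0) else None.

(* w is the value at len of lim_{e_1 -> 0} ... lim_{e_r -> 0} F, where
   es = [e_1; ...; e_r]: the head of the list is the outermost limit. *)
Fixpoint is_iterated_lim (F : (cedge G -> R) -> Riemann_sphere R)
    (es : seq (cedge G)) len (w : Riemann_sphere R) : Prop :=
  if es is e :: es' then
    exists g : R -> Riemann_sphere R,
      (\forall t \near 0^'+, is_iterated_lim F es' [eta len with e |-> t] (g t))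
      /\ g t @[t --> 0^'+] --> w
  else w = F len.

(* The limit formula for the path p starting at V_1, with c as the limit;
   f1p tau is the value f_1^(l)(i tau), which exists for all large tau.
   Degrees are taken in the compact part, the graph on which f_1 lives: for
   p = [::] one has -1 / f_1(i tau) = d tau + c + o(1) with d the number of
   ends of compact edges in V_1, so counting ends of half-lines as well would
   make the expression diverge. *)
Definition path_formula a len (p : seq (cedge G * bool)) (c : R) : Prop :=
  let vs := walk_vertices ord0 p in
  let D : R := (\sum_(m | m \in vs) deg (compact_part G) m)%N%:R
               - 2 * ((size vs)%:R - 1) in
  exists f1p : R -> Riemann_sphere R,
    (\forall tau \near +oo,
        is_iterated_lim (f1 a ('i * tau%:C)) (rev (walk_edges p)) len (f1p tau)
        /\ f1p tau <> Some 0)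
    /\ ((- tau * D)%:C - sphere_inv (f1p tau) : R[i]^o) @[tau --> +oo]
         --> (c%:C : R[i]^o).

End Limits.

(* Main.v *)
(** In terms of c = i k and y_e = exp (i k l_e) the matrix M^(i) - kappa is a
    weighted Laplacian, rational in c and y, and the limit l_e -> 0 of f_1 becomes
    the contraction of e: adding the row and column of one endpoint of e to those
    of the other and scaling by y_e^2 - 1, the determinant and the (1,1)-cofactor
    converge, up to the same factor -2, to those of the contracted graph.  With the
    path contracted and k = i tau, the off-diagonal entries decay exponentially, so
    that 1 / f_1 agrees with the corner entry up to o(1), and this entry is
    - tau (number of free ends at the merged vertex) - (sum of the a_m) + o(1).

    For uniqueness, equality of the scattering matrices gives the equality of the
    entries f_1 of (M - kappa)^-1 for both sets of constants; clearing denominators,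
    an exponential polynomial in k vanishes for k > 0.  As the lengths are
    rationally independent, its frequencies are distinct, so it vanishes identically
    in c and y.  In particular the lengths may be varied, the contractions apply,
    and the sums of the constants along all paths of the tree agree. *)

Require Import Defs.
From HB Require Import structures.
From mathcomp Require Import all_boot all_order all_algebra.
From mathcomp Require Import all_classical all_reals all_analysis.
From mathcomp Require Import complex.
From mathcomp Require Import ring lra.
Import Order.TTheory GRing.Theory Num.Theory.
Import numFieldNormedType.Exports.

Set Implicit Arguments.
Unset Strict Implicit.
Unset Printing Implicit Defensive.

Local Open Scope ring_scope.

(** Since [f_1] may be infinite, its limits are not taken directly: the determinant and the corner
    cofactor are followed separately, and the quotient is formed at the end, where for large [tau]
    the cofactor, unlike the determinant, is known to be nonzero. The cofactor is itself a
    difference of two determinants whose constants differ by 1 at the root, so contraction and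
    polynomiality are proved for determinants only. The formula concerns the matrix without
    half-lines, uniqueness the one with them; a half-line at [V_m] merely replaces [a_m] by
    [a_m - c], that is by [a_m + tau] at [c = - tau], whence the weights [w] that let one asymptotic
    analysis serve both. On the ray [k = i tau] all matrices are real, and so are the limits. The
    scattering data live at fixed lengths and real [k], where the matrices may be singular; the
    product [defect] vanishes at such points too, so that a polynomial identity without exceptions
    results. *)

Local Notation ohead := Defs.ohead.

(** * Simple paths in a spanning tree *)

Section Walks.
Context {N : nat} {G : graph N}.
Implicit Types (u v m : 'I_N) (d : cedge G * bool) (p q : seq (cedge G * bool)).

Definition flip d := (d.1, ~~ d.2).

Lemma walk_cat u p q v w : walk u p v -> walk v q w -> walk u (p ++ q) w.
Proof.
elim: p u => [|d p IH] u /=; first by move=> /eqP ->.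
by move=> /andP[-> hp] hq; rewrite (IH _ hp hq).
Qed.

Lemma walk_rev u p v : walk u p v -> walk v (rev (map flip p)) u.
Proof.
elim: p u => [|d p IH] u /=; first by rewrite eq_sym.
move=> /andP[/eqP hd /IH hp]; rewrite rev_cons -cats1; apply: walk_cat hp _.
by move: hd; case: d => e [] /= <-; rewrite !eqxx.
Qed.

Lemma walk_edges_rev p : walk_edges (rev (map flip p)) =i walk_edges p.
Proof.
move=> e; rewrite /walk_edges map_rev mem_rev -map_comp.
by rewrite (eq_map (_ : _ =1 fst)).
Qed.

Lemma last_walk u p v : walk u p v -> last u [seq ohead d | d <- p] = v.
Proof. by elim: p u => [|d p IH] u /=; [move/eqP | move=> /andP[_ /IH]]. Qed.

Lemma mem_walk_end u p v : walk u p v -> v \in walk_vertices u p.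
Proof. by move=> /last_walk <-; apply: mem_last. Qed.

Lemma edge_ends_walk u p v e b :
  walk u p v -> e \in walk_edges p -> cend e b \in walk_vertices u p.
Proof.
elim: p u => [//|d p IH] u /= /andP[/eqP hd hp].
rewrite !inE => /orP[/eqP ->|he]; last by have := IH _ hp he; rewrite inE => ->; rewrite orbT.
have [hb|hb] := eqVneq b d.2; first by rewrite hb -hd /otail eqxx.
have -> : b = ~~ d.2 by move: hb; case: (b); case: (d.2).
by rewrite /ohead eqxx orbT.
Qed.

Lemma uniq_walk_edges u p v :
  walk u p v -> uniq (walk_vertices u p) -> uniq (walk_edges p).
Proof.
elim: p u => [//|d p IH] u /= /andP[/eqP hd hp] /andP[hu hun].
rewrite (IH _ hp hun) andbT; apply/negP => he.
by move/negP: hu; apply; rewrite -hd; apply: edge_ends_walk hp he.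
Qed.

Lemma walk_suffix u p v x :
  walk u p v -> uniq (walk_vertices u p) -> x \in walk_vertices u p ->
  exists2 q, walk x q v /\ uniq (walk_vertices x q) &
             {subset walk_edges q <= walk_edges p}.
Proof.
elim: p u => [|d p IH] u.
  by move=> hp _; rewrite inE => /eqP ->; exists [::].
move=> hp hu; have [-> _|hx] := eqVneq x u; first by exists (d :: p).
rewrite inE (negPf hx) => /= hin.
move: hp hu => /= /andP[_ hp] /andP[_ hun].
have [q hq sq] := IH _ hp hun hin; exists q => // e /sq he.
by rewrite inE he orbT.
Qed.

(** Loop erasure: when the starting vertex reappears in the shortened tail, everything before that
    visit is dropped. *)
Lemma walk_shorten u p v : walk u p v ->
  exists2 q, walk u q v /\ uniq (walk_vertices u q) &
             {subset walk_edges q <= walk_edges p}.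
Proof.
elim: p u => [|d p IH] u; first by exists [::].
move=> /= /andP[/eqP hd hp]; have [q [hq uq] sq] := IH _ hp.
have [hu|hu] := boolP (u \in walk_vertices (ohead d) q).
  have [q' hq' sq'] := walk_suffix hq uq hu.
  by exists q' => // e /sq' /sq he; rewrite inE he orbT.
exists (d :: q) => [|e]; first by rewrite /= hd eqxx hq; split=> //; apply/andP.
by rewrite !inE => /orP[->//|/sq ->]; rewrite orbT.
Qed.

Lemma simple_path_closed (T : {set cedge G}) u p :
  simple_path_in T u p u -> p = [::].
Proof.
case: p => [//|d p] [[/= /andP[_ hp] _]] /andP[/negP hu _].
by case: hu; apply: mem_walk_end hp.
Qed.

(* If two simple paths start with distinct edges e and e', following the first
   one after e and the second one backwards gives a return walk avoiding e. *)
Lemma simple_path_unique (T : {set cedge G}) u p q v :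
  spanning_tree T -> simple_path_in T u p v -> simple_path_in T u q v -> p = q.
Proof.
move=> [_ hT]; elim: p u q => [|d p IH] u q hp.
  have <- : u = v by apply/eqP; case: hp => [[]].
  by move/simple_path_closed.
case: q => [|d' q] hq.
  have huv : u = v by apply/eqP; case: hq => [[]].
  by move: hp; rewrite -huv => /simple_path_closed.
have [edd|ndd] := eqVneq d d'.
  rewrite -edd in hq *; congr cons; apply: (IH (ohead d)).
    case: hp => [[/= /andP[_ hp] sp] /andP[_ up]]; split=> //; split=> // e he.
    by apply: sp; rewrite inE he orbT.
  case: hq => [[/= /andP[_ hq] sq] /andP[_ uq]]; split=> //; split=> // e he.
  by apply: sq; rewrite inE he orbT.
case: hp => [[/= /andP[/eqP hd hp] sp] /andP[up _]].
case: hq => [[/= /andP[/eqP hd' hq] sq] /andP[uq _]].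
(* Two different oriented edges over the same edge, both leaving [u], are the two directions of a
   loop; the first path would then revisit [u] at once. *)
have ne : d.1 != d'.1.
  apply: contra_neq ndd => e1.
  case: d d' e1 hd hd' up {sp IH hp uq sq hq} => [e b] [e' b'] /= <-.
  rewrite /otail /ohead /= => <- hb' hin; congr pair; apply/eqP; apply: contraT => nb.
  move/negP: hin; case; rewrite -hb'.
  have -> : b' = ~~ b by move: nb; case: b hb' => _; case: b'.
  by rewrite in_cons eqxx.
have nq : d.1 \notin walk_edges (d' :: q).
  rewrite /= inE (negPf ne) /=; apply/negP => he; case/negP: uq.
  by rewrite -hd /otail; apply: edge_ends_walk hq he.
have np : d.1 \notin walk_edges p.
  by apply/negP => he; case/negP: up; rewrite -{1}hd /otail; apply: edge_ends_walk hp he.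
have hq' : walk u (d' :: q) v by rewrite /= hd' eqxx.
have [w [hw uw] sw] := walk_shorten (walk_cat hp (walk_rev hq')).
have {}sw e : e \in walk_edges w -> (e \in walk_edges p) || (e \in walk_edges (d' :: q)).
  by move/sw; rewrite /walk_edges map_cat mem_cat; congr orb; apply: walk_edges_rev.
suff: d :: w = [::] by [].
apply: (hT u); first split.
- by rewrite /= hd eqxx.
- move=> e; rewrite inE => /orP[/eqP ->|/sw/orP[he|he]].
  + by apply: sp; rewrite inE eqxx.
  + by apply: sp; rewrite inE he orbT.
  + exact: sq.
- rewrite /= (uniq_walk_edges hw uw) andbT; apply/negP => /sw.
  by rewrite (negPf np) (negPf nq).
Qed.

Lemma walk_rcons u p d v :
  walk u (rcons p d) v = walk u p (otail d) && (ohead d == v).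
Proof. by elim: p u => [|d' p IH] u /=; [rewrite eq_sym | rewrite IH andbA]. Qed.

Lemma simple_path_rcons (T : {set cedge G}) u p d v :
  simple_path_in T u (rcons p d) v -> simple_path_in T u p (otail d).
Proof.
move=> [[]]; rewrite walk_rcons /simple_path_in /walk_in => /andP[-> _] sT.
rewrite /walk_vertices map_rcons -rcons_cons rcons_uniq => /andP[_ ->].
split=> //; split=> // e he; apply: sT.
by rewrite /walk_edges map_rcons mem_rcons inE he orbT.
Qed.

Lemma path_sums_injective (V : zmodType) (T : {set cedge G}) u
    (gamma : 'I_N -> seq (cedge G * bool)) (a b : 'I_N -> V) :
  spanning_tree T -> (forall m, simple_path_in T u (gamma m) m) ->
  (forall l, \sum_(m | m \in walk_vertices u (gamma l)) b m =
             \sum_(m | m \in walk_vertices u (gamma l)) a m) ->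
  b =1 a.
Proof.
move=> hT hg hs l; move: (hg l) (hs l).
case/lastP: (gamma l) => [|p d] hl.
  have <- : u = l by apply/eqP; case: hl => [[]].
  by rewrite /walk_vertices /= !(big_pred1 u) // => m; rewrite inE.
have hp := simple_path_rcons hl; have gp := simple_path_unique hT hp (hg _).
have hd : ohead d = l by case: hl => [[]]; rewrite walk_rcons => /andP[_ /eqP].
have sumE (f : 'I_N -> V) : \sum_(m | m \in walk_vertices u (rcons p d)) f m =
    f l + \sum_(m | m \in walk_vertices u (gamma (otail d))) f m.
  rewrite -gp (bigD1 l) /=; last first.
    by rewrite /walk_vertices map_rcons hd -rcons_cons mem_rcons inE eqxx.
  congr (_ + _); apply: eq_bigl => m.
  case: hl => _; rewrite /walk_vertices map_rcons hd -rcons_cons rcons_uniq.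
  case/andP=> nl _; rewrite mem_rcons in_cons.
  by have [->|_] := eqVneq m l; [rewrite (negPf nl) | rewrite andbT].
by rewrite !sumE hs => /addIr.
Qed.

End Walks.

(** * Complex exponential, sine and cosine *)

Section ComplexExponential.
Context {R : realType}.
Implicit Types z w : R[i].

Lemma cexpD z w : cexp (z + w) = cexp z * cexp w.
Proof.
case: z w => [a b] [c d]; rewrite /cexp /= expRD cosD sinD.
by apply/eqP; rewrite eq_complex /=; apply/andP; split; apply/eqP; ring.
Qed.

Lemma cexp0 : cexp (0 : R[i]) = 1.
Proof. by rewrite /cexp /= expR0 cos0 sin0 mul1r. Qed.

Lemma cexpN z : cexp (- z) = (cexp z)^-1.
Proof.
have h : cexp z * cexp (- z) = 1 by rewrite -cexpD subrr cexp0.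
have nz : cexp z != 0 by apply: contra_eq_neq h => ->; rewrite mul0r eq_sym oner_neq0.
by apply: (mulfI nz); rewrite h divff.
Qed.

Lemma cexp_neq0 z : cexp z != 0.
Proof.
apply/eqP => h; have := cexpD z (- z); rewrite subrr cexp0 h mul0r.
by move/eqP; rewrite oner_eq0.
Qed.

Lemma csinE z : csin z = (cexp ('i * z) - (cexp ('i * z))^-1) / (2 * 'i).
Proof. by rewrite /csin cexpN. Qed.

Lemma ccosE z : ccos z = (cexp ('i * z) + (cexp ('i * z))^-1) / 2.
Proof. by rewrite /ccos cexpN. Qed.

Lemma mulcii : 'i * 'i = -1 :> R[i].
Proof. by apply/eqP; rewrite eq_complex /= !mul0r !mulr0 !mul1r sub0r addr0 oppr0 !eqxx. Qed.

Lemma imag_neq0 : 'i != 0 :> R[i].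
Proof. by rewrite eq_complex /= oner_eq0 andbF. Qed.

Lemma invci : 'i^-1 = - 'i :> R[i].
Proof.
by apply: (mulfI imag_neq0); rewrite divff ?imag_neq0// mulrN mulcii opprK.
Qed.

End ComplexExponential.

(** * The Weyl matrix as a weighted Laplacian *)

Section WeightedLaplacian.
Variables (F : fieldType) (n : nat) (G : graph n.+1).
Implicit Types (S : seq 'I_n.+1) (c : F) (y : cedge G -> F).
Implicit Types (al : 'I_n.+1 -> F) (i j m v : 'I_n.+1).

(* For y = exp (i k l) and c = i k these are k / sin (k l) and k cot (k l),
   divided by c.  Both vanish for y = 1, since x / 0 = 0: the value y e = 1
   deletes the edge e. *)
Definition hop (y : F) := 2 * y / (y ^+ 2 - 1).
Definition stay (y : F) := (y ^+ 2 + 1) / (y ^+ 2 - 1).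

Lemma hop1 : hop 1 = 0. Proof. by rewrite /hop expr1n subrr invr0 mulr0. Qed.
Lemma stay1 : stay 1 = 0. Proof. by rewrite /stay expr1n subrr invr0 mulr0. Qed.

Definition contract S m := if m \in S then ord0 else m.

Definition at_vertex S m i : F := (i == contract S m)%:R.

(** If both ends lie at one vertex, the entry there is [2 (r - q)], which is the tangent term of a
    loop; so loops, also those created by merging, need no separate treatment. *)
Definition edge_form S (e : cedge G) (r q : F) i j :=
  r * (at_vertex S (cend e false) i * at_vertex S (cend e true) j
       + at_vertex S (cend e true) i * at_vertex S (cend e false) j)
  - q * (at_vertex S (cend e false) i * at_vertex S (cend e false) j
         + at_vertex S (cend e true) i * at_vertex S (cend e true) j).

(* The vertices in S are merged into the vertex 0.  To keep the size of the
   matrix, each of the others gets a row and a column with the only non-zero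
   entry c on the diagonal. *)
Definition lap S c y al : 'M[F]_n.+1 := \matrix_(i, j)
  (c * (\sum_e edge_form S e (hop (y e)) (stay (y e)) i j)
   - \sum_m al m * (at_vertex S m i * at_vertex S m j)
   + c * [&& i == j, i \in S & i != ord0]%:R).

Lemma eq_lap S c y y' al al' : y =1 y' -> al =1 al' -> lap S c y al = lap S c y' al'.
Proof.
move=> hy hal; apply/matrixP => i j; rewrite !mxE; congr (_ * _ - _ + _).
  by apply: eq_bigr => e _; rewrite hy.
by apply: eq_bigr => m _; rewrite hal.
Qed.

Lemma lap_diag_shift S c y al x : ord0 \in S ->
  lap S c y (fun m => al m - x * (m == ord0)%:R) =
  lap S c y al + x *: delta_mx ord0 ord0.
Proof.
move=> S0; apply/matrixP => i j; rewrite !mxE.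
have -> : \sum_m (al m - x * (m == ord0)%:R) * (at_vertex S m i * at_vertex S m j) =
    \sum_m al m * (at_vertex S m i * at_vertex S m j)
    - x * (at_vertex S ord0 i * at_vertex S ord0 j).
  rewrite (bigD1 (ord0 : 'I_n.+1)) //= [in RHS](bigD1 (ord0 : 'I_n.+1)) //= ?eqxx.
  under eq_bigr => m /negPf m0 do rewrite m0 mulr0 subr0.
  by rewrite mulr1 mulrBl addrAC.
by rewrite [in X in x * X]/at_vertex /contract S0 -natrM mulnb; ring.
Qed.

Lemma lap_set1E c y al i j :
  lap [:: ord0] c y al i j =
  c * (\sum_e edge_form [:: ord0] e (hop (y e)) (stay (y e)) i j)
  - al i * (i == j)%:R.
Proof.
have cE m : contract [:: ord0] m = m by rewrite /contract inE; case: eqP.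
rewrite mxE (_ : [&& i == j, i \in _ & _] = false) ?mulr0 ?addr0; last first.
  by rewrite inE; case: (i == ord0); rewrite ?andbF.
congr (_ - _); rewrite (bigD1 i) //= big1 ?addr0 /at_vertex ?cE ?eqxx ?mul1r 1?eq_sym //.
by move=> m /negPf ni; rewrite cE eq_sym ni mul0r mulr0.
Qed.

End WeightedLaplacian.

Lemma map_lap (F F' : fieldType) (f : {rmorphism F -> F'}) n (G : graph n.+1)
    S c (y : cedge G -> F) al :
  map_mx f (lap S c y al) = lap S (f c) (f \o y) (f \o al).
Proof.
have fV (P : seq 'I_n.+1) m i : f (at_vertex F P m i) = at_vertex F' P m i.
  by rewrite /at_vertex rmorph_nat.
apply/matrixP => i j; rewrite !mxE !(rmorphB, rmorphD, rmorphM, rmorph_nat) /=.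
rewrite !rmorph_sum /=; congr (_ * _ - _ + _); apply: eq_bigr => x _; last first.
  by rewrite !rmorphM !fV.
rewrite /edge_form /hop /stay !(rmorphB, rmorphD, rmorphM) /= !fmorphV /=.
by rewrite !(rmorphB, rmorphD, rmorphM, rmorphXn, rmorph1) /= !fV.
Qed.

Section WeylLaplacian.
Context {R : realType} {n : nat}.
Variable G : graph n.+1.
Implicit Types (len : cedge G -> R) (k : R[i]) (a : 'rV[R]_n.+1).

(** At the zeros of the sine both sides are 0 by the convention for inverses; thus the identity, and
    with it the description of the Weyl matrix, has no exceptional [k]. *)
Lemma hop_csin k (l : R) :
  k * (csin (k * l%:C))^-1 = 'i * k * hop (cexp ('i * k * l%:C)).
Proof.
rewrite csinE mulrA /hop; set E := cexp _; have E0 : E != 0 by apply: cexp_neq0.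
have [h|h] := eqVneq (E ^+ 2) 1.
  have -> : E - E^-1 = 0 by apply: (mulfI E0); rewrite mulrBr divff // mulr0 -expr2 h subrr.
  by rewrite mul0r invr0 h subrr invr0 !mulr0.
have h' : E ^+ 2 - 1 != 0 by rewrite subr_eq0.
by have := @imag_neq0 R => i0; field; rewrite E0 h' i0.
Qed.

Lemma stay_ccot k (l : R) :
  k * ccot (k * l%:C) = 'i * k * stay (cexp ('i * k * l%:C)).
Proof.
rewrite /ccot csinE ccosE !mulrA /stay; set E := cexp _.
have E0 : E != 0 by apply: cexp_neq0.
have [h|h] := eqVneq (E ^+ 2) 1.
  have -> : E - E^-1 = 0 by apply: (mulfI E0); rewrite mulrBr divff // mulr0 -expr2 h subrr.
  by rewrite mul0r invr0 h subrr invr0 !mulr0.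
have h' : E ^+ 2 - 1 != 0 by rewrite subr_eq0.
by have := @imag_neq0 R => i0; field; rewrite E0 h' i0.
Qed.

(** Half-angle formula [tan (x/2) = (1 - cos x) / sin x]. It survives at [sin x = 0]: there [hop]
    and [stay] are 0, and so is the tangent, either truly or, at its poles, by the convention for
    inverses. *)
Lemma loop_ctan k (l : R) :
  k * ctan (k * l%:C / 2) =
  'i * k * (hop (cexp ('i * k * l%:C)) - stay (cexp ('i * k * l%:C))).
Proof.
rewrite /ctan csinE ccosE /hop /stay.
have -> : 'i * k * l%:C = 'i * (k * l%:C / 2) + 'i * (k * l%:C / 2) :> R[i] by field.
rewrite cexpD; set E := cexp _; have E0 : E != 0 by apply: cexp_neq0.
have i0 := @imag_neq0 R.
have -> : (E - E^-1) / (2 * 'i) / ((E + E^-1) / 2) = - 'i * ((E ^+ 2 - 1) / (E ^+ 2 + 1)).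
  rewrite -invci; have [h|h] := eqVneq (E ^+ 2 + 1) 0.
    have -> : E + E^-1 = 0 by apply: (mulfI E0); rewrite mulrDr divff // mulr0 -expr2.
    by rewrite mul0r h invr0 !mulr0.
  by field; rewrite E0 h i0.
have -> : (E * E) ^+ 2 - 1 = (E ^+ 2 - 1) * (E ^+ 2 + 1) by ring.
have [h|h] := eqVneq (E ^+ 2 - 1) 0.
  by rewrite h !mul0r invr0 !mulr0 subrr !mulr0.
have [h'|h'] := eqVneq (E ^+ 2 + 1) 0.
  by rewrite h' mulr0 invr0 !mulr0 subrr !mulr0.
by field; rewrite h h'.
Qed.

Lemma Weyl_int_lap len k a :
  Weyl_int len k - kappa a =
  lap [:: ord0] ('i * k) (fun e => cexp ('i * k * (len e)%:C))
      (fun m => (a ord0 m)%:C).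
Proof.
have cE m : contract [:: ord0] m = m :> 'I_n.+1 by rewrite /contract inE; case: eqP.
apply/matrixP => i j; rewrite lap_set1E !mxE; congr (_ - _); last first.
  by rewrite mulr_natr.
have [<-|nij] := eqVneq i j.
  rewrite mulNr mulrBr opprB addrC !mulr_sumr.
  rewrite (big_mkcond (nonloop_at i)) (big_mkcond (loop_at i)) /= -sumrN -big_split.
  apply: eq_bigr => e _; rewrite /nonloop_at /loop_at /is_loop /edge_form /at_vertex !cE.
  rewrite (mulrCA k 2) (loop_ctan k (len e)) (stay_ccot k (len e)).
  move: (hop _) (stay _) => r q.
  rewrite ![i == cend _ _]eq_sym.
  have [<-|n01] := eqVneq (cend e false) (cend e true) => /=.
    by case: eqP => _ /=; ring.
  have [h0|h0] := eqVneq (cend e false) i; have [h1|h1] := eqVneq (cend e true) i => /=.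
  - by rewrite h0 h1 eqxx in n01.
  - by ring.
  - by ring.
  - by ring.
rewrite !mulr_sumr (big_mkcond (connects i j)) /=; apply: eq_bigr => e _.
rewrite /connects /edge_form /at_vertex !cE (hop_csin k (len e)).
rewrite ![i == cend _ _]eq_sym ![j == cend _ _]eq_sym.
have nbi (x : 'I_n.+1) : (x == i) && (x == j) = false.
  by apply/negbTE; apply: contra nij => /andP[/eqP <- /eqP <-].
move: (nbi (cend e false)) (nbi (cend e true)).
by case: (_ == i); case: (_ == j); case: (_ == i); case: (_ == j) => //= _ _; ring.
Qed.

Lemma tr_lap (F : fieldType) S c (y : cedge G -> F) al : (lap S c y al)^T = lap S c y al.
Proof.
apply/matrixP => i j; rewrite !mxE; congr (_ * _ - _ + _ * _%:R).
- by apply: eq_bigr => e _; rewrite /edge_form; ring.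
- by apply: eq_bigr => m _; ring.
- by have [->|] := eqVneq j i; rewrite ?eqxx // eq_sym => /negPf ->.
Qed.

End WeylLaplacian.

(** * Solutions of the differential equation on one edge *)

Section ComplexDerivative.
Context {R : realType}.
Implicit Types (f g : R -> R[i]) (x : R) (w d : R[i]).

Local Notation Re := (@complex.Re R).
Local Notation Im := (@complex.Im R).

Lemma ReM w d : Re (w * d) = Re w * Re d - Im w * Im d.
Proof. by case: w d => [? ?] []. Qed.

Lemma ImM w d : Im (w * d) = Re w * Im d + Im w * Re d.
Proof. by case: w d => [? ?] []. Qed.

Lemma ReB w d : Re (w - d) = Re w - Re d.
Proof. by case: w d => [? ?] []. Qed.

Lemma ImB w d : Im (w - d) = Im w - Im d.
Proof. by case: w d => [? ?] []. Qed.

Definition cderiv f x d :=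
  is_derive x (1 : R) (Re \o f) (Re d) /\ is_derive x (1 : R) (Im \o f) (Im d).

Lemma cderiv_eq f g x d d' : cderiv f x d -> f =1 g -> d = d' -> cderiv g x d'.
Proof. by move=> + /funext <- <-. Qed.

Lemma cderivM f g x df dg : cderiv f x df -> cderiv g x dg ->
  cderiv (fun t => f t * g t) x (f x * dg + df * g x).
Proof.
move=> [fr fi] [gr gi]; split.
  rewrite (_ : Re \o _ = (Re \o f) * (Re \o g) - (Im \o f) * (Im \o g)); last first.
    by apply/funext => t; rewrite /= ReM.
  apply: is_derive_eq; rewrite /= /GRing.scale /=.
  case: (f x) (g x) df dg {fr fi gr gi} => [? ?] [? ?] [? ?] [? ?] /=; ring.
rewrite (_ : Im \o _ = (Re \o f) * (Im \o g) + (Im \o f) * (Re \o g)); last first.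
  by apply/funext => t; rewrite /= ImM.
apply: is_derive_eq; rewrite /= /GRing.scale /=.
  case: (f x) (g x) df dg {fr fi gr gi} => [? ?] [? ?] [? ?] [? ?] /=; ring.
Qed.

Lemma cderivB f g x df dg : cderiv f x df -> cderiv g x dg ->
  cderiv (fun t => f t - g t) x (df - dg).
Proof.
move=> [fr fi] [gr gi]; split.
  rewrite (_ : Re \o _ = (Re \o f) - (Re \o g)); last by apply/funext => t; rewrite /= ReB.
  by apply: is_derive_eq; rewrite ReB.
rewrite (_ : Im \o _ = (Im \o f) - (Im \o g)); last by apply/funext => t; rewrite /= ImB.
by apply: is_derive_eq; rewrite ImB.
Qed.

Lemma cderiv_cst w x : cderiv (fun=> w) x 0.
Proof. by split; apply: is_derive_cst. Qed.

Lemma cderivZ w f x df : cderiv f x df -> cderiv (fun t => w * f t) x (w * df).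
Proof.
move=> h; apply: cderiv_eq (cderivM (cderiv_cst w x) h) _ _ => //.
by rewrite mul0r addr0.
Qed.

Lemma cderiv_cexp w (b : R) x :
  cderiv (fun t => cexp (w * (t - b)%:C)) x (w * cexp (w * (x - b)%:C)).
Proof.
pose g := (fun t : R => t - b).
have hg : is_derive x (1 : R) g 1.
  rewrite /g (_ : (fun t : R => t - b) = id - cst b); last exact/funext.
  by apply: is_derive_eq; rewrite subr0.
have hs (s : R) : is_derive x (1 : R) (s *: g) s.
  by apply: is_derive_eq; rewrite /GRing.scale /= mulr1.
have he (s : R) := is_derive1_comp (is_derive_expR ((s *: g) x)) (hs s).
have hc (s : R) := is_derive1_comp (is_derive_cos ((s *: g) x)) (hs s).
have hn (s : R) := is_derive1_comp (is_derive_sin ((s *: g) x)) (hs s).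
have cE t : cexp (w * (t - b)%:C) =
    expR (Re w * g t) * cos (Im w * g t) +i* (expR (Re w * g t) * sin (Im w * g t)).
  case: w => p q; rewrite /cexp /g /=; apply/eqP; rewrite eq_complex /=.
  by rewrite !mulr0 subr0 add0r !mul0r subr0 addr0 !eqxx.
split.
  rewrite (_ : Re \o _ = (expR \o (Re w *: g)) * (cos \o (Im w *: g))); last first.
    by apply/funext => t; rewrite /comp cE.
  apply: is_derive_eq (is_deriveM (he (Re w)) (hc (Im w))) _.
  rewrite cE ReM /= /GRing.scale /=; ring.
rewrite (_ : Im \o _ = (expR \o (Re w *: g)) * (sin \o (Im w *: g))); last first.
  by apply/funext => t; rewrite /comp cE.
apply: is_derive_eq (is_deriveM (he (Re w)) (hn (Im w))) _.
rewrite cE ImM /= /GRing.scale /=; ring.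
Qed.

Lemma cderiv_csin w (b : R) x :
  cderiv (fun t => csin (w * (t - b)%:C)) x (w * ccos (w * (x - b)%:C)).
Proof.
have h s := cderiv_cexp s b x.
apply: cderiv_eq (cderivZ (2 * 'i)^-1 (cderivB (h ('i * w)) (h (- ('i * w))))) _ _ => [t|].
  by rewrite /csin [RHS]mulrC mulNr -!(mulrA 'i w).
rewrite /ccos !mulNr -!(mulrA 'i w); set E := cexp _; set E' := cexp _.
by have i0 := @imag_neq0 R; field.
Qed.

Lemma cderiv_ccos w (b : R) x :
  cderiv (fun t => ccos (w * (t - b)%:C)) x (- (w * csin (w * (x - b)%:C))).
Proof.
have h s := cderiv_cexp s b x.
apply: cderiv_eq (cderivZ 2^-1 (cderivB (h ('i * w)) (cderivZ (-1) (h (- ('i * w)))))) _ _ => [t|].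
  by rewrite /ccos [RHS]mulrC mulN1r opprK mulNr -!(mulrA 'i w).
rewrite /csin !mulNr -!(mulrA 'i w); set E := cexp _; set E' := cexp _.
rewrite -[2 * 'i]mulrC invfM invci; by field.
Qed.

Lemma csin0 : csin (0 : R[i]) = 0.
Proof. by rewrite /csin mulr0 oppr0 subrr mul0r. Qed.

Lemma ccos0 : ccos (0 : R[i]) = 1.
Proof. by rewrite /ccos mulr0 oppr0 cexp0; field. Qed.

Lemma csinN w : csin (- w) = - csin w.
Proof. by rewrite /csin mulrN opprK -[RHS]mulNr opprB. Qed.

Lemma ccosN w : ccos (- w) = ccos w.
Proof. by rewrite /ccos mulrN opprK addrC. Qed.

Lemma zero_derivative_endpoints (h : R -> R) (l : R) : 0 < l ->
  {within `[0, l], continuous h} ->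
  (forall x, 0 < x < l -> is_derive x (1 : R) h 0) -> h l = h 0.
Proof.
move=> l0 hc hd; apply/eqP; rewrite -subr_eq0.
have hd' x : x \in `]0, l[ -> is_derive x (1 : R) h (cst 0 x).
  by rewrite in_itv /=; apply: hd.
by have [c _ ->] := MVT l0 hd' hc; rewrite mul0r.
Qed.

(** The Wronskian of two solutions of the same equation has derivative 0. It stands in for a
    uniqueness theorem: explicit choices of [g] express the end derivatives of [u] by its end
    values. *)
Lemma edge_Wronskian (z : R[i]) (l : R) u du g dg : 0 < l ->
  edge_solution z l u du ->
  (forall x, cderiv g x (dg x)) -> (forall x, cderiv dg x (- (z * g x))) ->
  u l * dg l - du l * g l = u 0 * dg 0 - du 0 * g 0.
Proof.
move=> l0 hu hg hdg.
pose W t := u t * dg t - du t * g t.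
have [[cur cdr dr] [cui cdi di]] := (hu _ (or_introl erefl), hu _ (or_intror erefl)).
have dW x : 0 < x < l -> cderiv W x 0.
  move=> hx; have [ur dur] := dr x hx; have [ui dui] := di x hx.
  have hcu : cderiv u x (du x) by split.
  have hcdu : cderiv du x (- (z * u x)) by split.
  apply: cderiv_eq (cderivB (cderivM hcu (hdg x)) (cderivM hcdu (hg x))) _ _ => //.
  by ring.
have cg f df : (forall x, cderiv f x (df x)) ->
    {within `[0, l], continuous (Re \o f)} /\ {within `[0, l], continuous (Im \o f)}.
  by move=> hf; split; apply: derivable_within_continuous => x _; case: (hf x) => [[]] // ? ? [].
have [cgr cgi] := cg _ _ hg; have [cdgr cdgi] := cg _ _ hdg.
have WRe : W l = W 0.
  apply/eqP; rewrite eq_complex; apply/andP; split; apply/eqP.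
    apply: (zero_derivative_endpoints (h := Re \o W) l0); last by move=> x /dW [].
    rewrite (_ : Re \o W = ((Re \o u) * (Re \o dg) - (Im \o u) * (Im \o dg))
       - ((Re \o du) * (Re \o g) - (Im \o du) * (Im \o g))); last first.
      by apply/funext => t; rewrite /W /= ReB !ReM.
    move=> x; apply: cvgB; apply: cvgB; apply: cvgM; by [apply: cur | apply: cdgr
      | apply: cui | apply: cdgi | apply: cdr | apply: cgr | apply: cdi | apply: cgi].
  apply: (zero_derivative_endpoints (h := Im \o W) l0); last by move=> x /dW [].
  rewrite (_ : Im \o W = ((Re \o u) * (Im \o dg) + (Im \o u) * (Re \o dg))
     - ((Re \o du) * (Im \o g) + (Im \o du) * (Re \o g))); last first.
    by apply/funext => t; rewrite /W /= ImB !ImM.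
  move=> x; apply: cvgB; apply: cvgD; apply: cvgM; by [apply: cur | apply: cdgr
      | apply: cui | apply: cdgi | apply: cdr | apply: cgr | apply: cdi | apply: cgi].
exact: WRe.
Qed.

Lemma edge_derivative0 k (l : R) u du : 0 < l -> edge_solution (k ^+ 2) l u du ->
  du 0 * csin (k * l%:C) = k * (u l - u 0 * ccos (k * l%:C)).
Proof.
move=> l0 hu.
have h : u l * (k * ccos (k * (l - l)%:C)) - du l * csin (k * (l - l)%:C)
       = u 0 * (k * ccos (k * (0 - l)%:C)) - du 0 * csin (k * (0 - l)%:C).
  (* This sine vanishes at [l], which removes the unknown derivative of [u] there. *)
  apply: (edge_Wronskian (g := fun t => csin (k * (t - l)%:C))
     (dg := fun t => k * ccos (k * (t - l)%:C)) l0 hu) => x; first exact: cderiv_csin.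
  by apply: cderiv_eq (cderivZ k (cderiv_ccos k l x)) _ _ => //; ring.
move: h; rewrite subrr sub0r rmorphN mulrN mulr0
  csin0 ccos0 csinN ccosN mulr0 mulr1 subr0 mulrN opprK.
by move=> h; rewrite mulrBr [k * u l]mulrC h; ring.
Qed.

Lemma edge_derivative1 k (l : R) u du : 0 < l -> edge_solution (k ^+ 2) l u du ->
  - du l * csin (k * l%:C) = k * (u 0 - u l * ccos (k * l%:C)).
Proof.
move=> l0 hu.
have h : u l * (k * ccos (k * (l - 0)%:C)) - du l * csin (k * (l - 0)%:C)
       = u 0 * (k * ccos (k * (0 - 0)%:C)) - du 0 * csin (k * (0 - 0)%:C).
  apply: (edge_Wronskian (g := fun t => csin (k * (t - 0)%:C))
     (dg := fun t => k * ccos (k * (t - 0)%:C)) l0 hu) => x; first exact: cderiv_csin.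
  by apply: cderiv_eq (cderivZ k (cderiv_ccos k 0 x)) _ _ => //; ring.
move: h; rewrite !subr0 mulr0 csin0 ccos0 mulr0 mulr1 subr0.
by move=> h; rewrite mulrBr [k * u 0]mulrC -h; ring.
Qed.

Lemma edge_solution_exists k (l : R) (p q : R[i]) : csin (k * l%:C) != 0 ->
  exists u du, [/\ edge_solution (k ^+ 2) l u du, u 0 = p & u l = q].
Proof.
move=> s0; set s := csin _ in s0.
pose u t := q / s * csin (k * (t - 0)%:C) - p / s * csin (k * (t - l)%:C).
pose du t := q / s * (k * ccos (k * (t - 0)%:C)) - p / s * (k * ccos (k * (t - l)%:C)).
have hu x : cderiv u x (du x).
  by apply: cderivB; apply: cderivZ; apply: cderiv_csin.
have hdu x : cderiv du x (- (k ^+ 2 * u x)).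
  apply: cderiv_eq (cderivB (cderivZ _ (cderivZ _ (cderiv_ccos _ _ _)))
                            (cderivZ _ (cderivZ _ (cderiv_ccos _ _ _)))) (frefl _) _.
  by rewrite /u; ring.
exists u, du; split.
- move=> part [] -> ; split.
  + by apply: derivable_within_continuous => x _; case: (hu x) => [[]].
  + by apply: derivable_within_continuous => x _; case: (hdu x) => [[]].
  + by move=> x _; case: (hu x) (hdu x) => [? _] [].
  + by apply: derivable_within_continuous => x _; case: (hu x) => _ [].
  + by apply: derivable_within_continuous => x _; case: (hdu x) => _ [].
  + by move=> x _; case: (hu x) (hdu x) => [_ ?] [].
- by rewrite /u subrr mulr0 csin0 mulr0 !sub0r rmorphN mulrN csinN mulrN opprK divfK.
- by rewrite /u subrr mulr0 csin0 mulr0 !subr0 divfK.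
Qed.

End ComplexDerivative.

(** * The Robin-to-Dirichlet map *)

Section RobinToDirichlet.
Context {R : realType} {n : nat}.
Variable G : graph n.+1.
Implicit Types (len : cedge G -> R) (k : R[i]) (a : 'rV[R]_n.+1).

Lemma sum_normal_derivatives len k a (u du : cedge G -> R -> R[i]) (U : 'cV[R[i]]_n.+1) m :
  (forall e, 0 < len e) -> (forall e, csin (k * (len e)%:C) != 0) ->
  (forall e, edge_solution (k ^+ 2) (len e) (u e) (du e)) ->
  (forall x : cedge G * bool, u x.1 (endpoint len x) = U (cend x.1 x.2) ord0) ->
  \sum_(x : cedge G * bool | cend x.1 x.2 == m) normal_derivative len du x
    - (a ord0 m)%:C * U m ord0 =
  ((Weyl_int len k - kappa a) *m U) m ord0.
Proof.
move=> hl hs hu hU; rewrite Weyl_int_lap mxE.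
have cE x : contract [:: ord0] x = x :> 'I_n.+1 by rewrite /contract inE; case: eqP.
under [RHS]eq_bigr => j _ do rewrite lap_set1E mulrBl.
rewrite sumrB; congr (_ - _); last first.
  rewrite (bigD1 m) //= eqxx mulr1 big1 ?addr0 // => j; rewrite eq_sym => /negPf ->.
  by rewrite mulr0 mul0r.
have -> : \sum_(x : cedge G * bool | cend x.1 x.2 == m) normal_derivative len du x =
    \sum_e ((m == cend e false)%:R * normal_derivative len du (e, false)
            + (m == cend e true)%:R * normal_derivative len du (e, true)).
  rewrite big_mkcond /= -(pair_big predT predT (fun e b =>
    if cend e b == m then normal_derivative len du (e, b) else 0)) /=.
  apply: eq_bigr => e _; rewrite big_bool /= addrC.
  by congr (_ + _); rewrite eq_sym; case: eqP; rewrite (mul0r, mul1r).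
under [RHS]eq_bigr => j _ do rewrite -mulrA big_distrl /= big_distrr /=.
rewrite exchange_big /=; apply: eq_bigr => e _.
set K := 'i * k; set r := hop _; set q := stay _.
have U0 : u e 0 = U (cend e false) ord0 := hU (e, false).
have U1 : u e (len e) = U (cend e true) ord0 := hU (e, true).
have rE : k / csin (k * (len e)%:C) = K * r := hop_csin k (len e).
have qE : k * ccot (k * (len e)%:C) = K * q := stay_ccot k (len e).
have n0 : normal_derivative len du (e, false) =
    K * r * U (cend e true) ord0 - K * q * U (cend e false) ord0.
  rewrite /normal_derivative /endpoint /= expr0 mul1r; apply: (mulIf (hs e)).
  rewrite (edge_derivative0 (hl e) (hu e)) U0 U1 -rE -qE /ccot.
  by have h := hs e; field.
have n1 : normal_derivative len du (e, true) =
    K * r * U (cend e false) ord0 - K * q * U (cend e true) ord0.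
  rewrite /normal_derivative /endpoint /= expr1 mulN1r; apply: (mulIf (hs e)).
  rewrite (edge_derivative1 (hl e) (hu e)) U0 U1 -rE -qE /ccot.
  by have h := hs e; field.
have pick (x : 'I_n.+1) : \sum_j (j == x)%:R * U j ord0 = U x ord0.
  by rewrite (bigD1 x) //= eqxx mul1r big1 ?addr0 // => j /negPf ->; rewrite mul0r.
rewrite n0 n1.
transitivity (K * (r * ((m == cend e false)%:R * (\sum_j (j == cend e true)%:R * U j ord0)
    + (m == cend e true)%:R * (\sum_j (j == cend e false)%:R * U j ord0))
  - q * ((m == cend e false)%:R * (\sum_j (j == cend e false)%:R * U j ord0)
    + (m == cend e true)%:R * (\sum_j (j == cend e true)%:R * U j ord0)))).
  by rewrite !pick; ring.
rewrite !mulr_sumr -!big_split /= !mulr_sumr -sumrB mulr_sumr; apply: eq_bigr => j _.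
by rewrite /edge_form /at_vertex !cE; ring.
Qed.

(** At a regular point the matching conditions are an invertible linear system for the vertex
    values. Conversely, the sines being nonzero, any vertex values extend to solutions along the
    edges. *)
Lemma Robin_to_DirichletE len a z phi psi :
  (forall e, 0 < len e) -> regular_point len a z ->
  (Robin_to_Dirichlet len a z phi psi <->
   P_ext G *m phi = phi /\ psi = Robin_to_Dirichlet_mx len a z *m phi).
Proof.
move=> hl [hs hA]; set k := sqrtC z in hs hA *.
have zk : z = k ^+ 2 by rewrite /k sqrtCK.
rewrite /Robin_to_Dirichlet_mx -/k; set A := _ - _ in hA *; split.
  move=> [u [du [U [hu hU hphi hP ->]]]]; split=> //.
  rewrite -mulmxA hP -mulmxA; congr (_ *m _).
  rewrite -[LHS](mulKmx hA); congr (_ *m _); apply/matrixP => m j; rewrite ord1.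
  by rewrite -hphi (@sum_normal_derivatives len k a u) // -zk.
move=> [hP ->]; rewrite -mulmxA hP; set U := invmx A *m phi.
have /choice [u hu] e : exists u : R -> R[i], exists du : R -> R[i],
    [/\ edge_solution z (len e) u du, u 0 = U (cend e false) ord0
       & u (len e) = U (cend e true) ord0].
  by rewrite zk; apply: edge_solution_exists.
have /choice [du {}hu] := hu; exists u, du, U; split=> //.
- by move=> e; case: (hu e).
- by move=> [e []]; case: (hu e).
- move=> m; rewrite (@sum_normal_derivatives len k a u) //.
  + by rewrite -/A /U mulKVmx.
  + by move=> e; rewrite -zk; case: (hu e).
  + by move=> [e []]; case: (hu e).
- by rewrite -mulmxA.
Qed.

End RobinToDirichlet.

(** * Determinants under contraction of an edge *)

Section DeterminantFacts.
Variables (F : comNzRingType) (n : nat).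
Implicit Types (A B : 'M[F]_n.+1) (v : 'I_n.+1).

(** The congruence [E^T A E] with [E = 1 + delta_mx v ord0], which is what a quadratic form
    undergoes when the vertex [v] is identified with the root. *)
Definition merge_mx v A : 'M[F]_n.+1 := \matrix_(i, j)
  (A i j + (i == ord0)%:R * A v j + (j == ord0)%:R * A i v
   + (i == ord0)%:R * (j == ord0)%:R * A v v).

Lemma merge_mxE v A i j : merge_mx v A i j =
  A i j + (i == ord0)%:R * A v j + (j == ord0)%:R * A i v
   + (i == ord0)%:R * (j == ord0)%:R * A v v.
Proof. exact: mxE. Qed.

Lemma det_merge_mx v A : v != ord0 -> \det (merge_mx v A) = \det A.
Proof.
move=> v0; pose E : 'M[F]_n.+1 := 1%:M + delta_mx v ord0.
have dE : \det E = 1.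
  rewrite det_trig.
    rewrite big1 // => i _; rewrite !mxE eqxx.
    by case: (eqVneq i v) => [->|_]; rewrite ?(negPf v0) ?andbF addr0.
  apply/is_trig_mxP => i j ij; rewrite !mxE.
  have -> : (i == j) = false by apply/negbTE; rewrite neq_ltn ij.
  have -> : (j == ord0) = false by apply/negbTE; rewrite -val_eqE /= -lt0n (leq_ltn_trans _ ij).
  by rewrite andbF addr0.
have -> : merge_mx v A = E^T *m A *m E.
  have dmul (B : 'M[F]_n.+1) j i : (delta_mx ord0 v *m B) i j = (i == ord0)%:R * B v j.
    rewrite mxE (bigD1 v) //= big1 => [|k /negPf kv]; first by rewrite mxE eqxx andbT addr0.
    by rewrite mxE kv andbF mul0r.
  have mdul (B : 'M[F]_n.+1) i j : (B *m delta_mx v ord0) i j = (j == ord0)%:R * B i v.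
    rewrite mxE (bigD1 v) //= big1 => [|k /negPf kv]; first by rewrite mxE eqxx mulrC addr0.
    by rewrite mxE kv mulr0.
  have EA i j : (E^T *m A) i j = A i j + (i == ord0)%:R * A v j.
    by rewrite /E linearD /= trmx1 trmx_delta mulmxDl mul1mx mxE dmul.
  apply/matrixP => i j; rewrite {2}/E mulmxDr mulmx1 [RHS]mxE mdul !EA mxE; ring.
by rewrite !det_mulmx det_tr dE mulr1 mul1r.
Qed.

Definition scale_row v x A : 'M[F]_n.+1 :=
  \matrix_(i, j) ((if i == v then x else 1) * A i j).

Lemma scale_rowE v x A i j : scale_row v x A i j = (if i == v then x else 1) * A i j.
Proof. exact: mxE. Qed.

Lemma det_scale_row v x A : \det (scale_row v x A) = x * \det A.
Proof.
have -> : scale_row v x A = diag_mx (\row_i (if i == v then x else 1)) *m A.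
  by apply/matrixP => i j; rewrite mul_diag_mx !mxE.
rewrite det_mulmx det_diag (bigD1 v) //= mxE eqxx big1 ?mulr1 // => i /negPf iv.
by rewrite mxE iv.
Qed.

Lemma det_pinned v b x A B :
  (forall j, A v j = (j == v)%:R * (b * x)) -> (forall j, B v j = (j == v)%:R * x) ->
  (forall i j, i != v -> j != v -> A i j = B i j) -> \det A = b * \det B.
Proof.
move=> hA hB hAB; rewrite (expand_det_row A v) (expand_det_row B v).
rewrite (bigD1 v) //= [in RHS](bigD1 v) //= hA hB eqxx !mul1r !big1 ?addr0; last 2 first.
- by move=> j /negPf jv; rewrite hB jv !mul0r.
- by move=> j /negPf jv; rewrite hA jv !mul0r.
rewrite -!mulrA; do 2!congr (_ * _); rewrite /cofactor; congr (_ * \det _).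
apply/matrixP => i j; rewrite !mxE; apply: hAB; rewrite eq_sym; exact: neq_lift.
Qed.

End DeterminantFacts.

Section Contraction.
Variables (F : fieldType) (n : nat) (G : graph n.+1).
Implicit Types (S : seq 'I_n.+1) (c : F) (y : cedge G -> F).
Implicit Types (al : 'I_n.+1 -> F) (i j m v : 'I_n.+1).

(** The weight 1 deletes [e], as [hop 1 = stay 1 = 0]; this isolates the part that becomes singular
    when the length of [e] tends to 0. *)
Lemma lap_edge S c y al e s i j :
  lap S c [eta y with e |-> s] al i j =
  lap S c [eta y with e |-> 1] al i j + c * edge_form S e (hop s) (stay s) i j.
Proof.
rewrite !mxE (bigD1 e) //= [in RHS](bigD1 e) //= !eqxx.
rewrite (eq_bigr (fun x => edge_form S x (hop (y x)) (stay (y x)) i j)); last first.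
  by move=> x /negPf ->.
rewrite [in RHS](eq_bigr (fun x => edge_form S x (hop (y x)) (stay (y x)) i j)); last first.
  by move=> x /negPf ->.
rewrite [edge_form _ e (hop 1) _ _ _](_ : _ = 0); first by ring.
by rewrite hop1 stay1 /edge_form !mul0r subrr.
Qed.

Lemma at_vertex_rcons S v m i : ord0 \in S -> v \notin S -> i != v ->
  at_vertex F (rcons S v) m i = at_vertex F S m i + (i == ord0)%:R * at_vertex F S m v.
Proof.
move=> S0 Sv iv; rewrite /at_vertex /contract mem_rcons inE.
have v0 : v != ord0 by apply: contraNneq Sv => ->.
have [->|mv] := eqVneq m v; first by rewrite (negPf Sv) (negPf iv) eqxx mulr1 add0r.
by case: ifP => mS /=; rewrite ?(negPf v0) 1?[v == m]eq_sym ?(negPf mv) mulr0 addr0.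
Qed.

Lemma at_vertex_contracted S v m : ord0 \in S -> v \in S -> v != ord0 ->
  at_vertex F S m v = 0.
Proof.
move=> S0 Sv v0; rewrite /at_vertex /contract; case: ifP => mS; first by rewrite (negPf v0).
by case: eqP mS => // <-; rewrite Sv.
Qed.

Lemma merge_lap S v c y al i j : ord0 \in S -> v \notin S -> i != v -> j != v ->
  merge_mx v (lap S c y al) i j = lap (rcons S v) c y al i j.
Proof.
move=> S0 Sv iv jv; rewrite !mxE !(mem_rcons, inE) (negPf Sv) (negPf iv) /= !andbF.
have -> : \sum_e edge_form (rcons S v) e (hop (y e)) (stay (y e)) i j =
   \sum_e edge_form S e (hop (y e)) (stay (y e)) i j
   + (i == ord0)%:R * (\sum_e edge_form S e (hop (y e)) (stay (y e)) v j)
   + (j == ord0)%:R * (\sum_e edge_form S e (hop (y e)) (stay (y e)) i v)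
   + (i == ord0)%:R * (j == ord0)%:R *
     (\sum_e edge_form S e (hop (y e)) (stay (y e)) v v).
  rewrite !mulr_sumr -!big_split /=; apply: eq_bigr => e _.
  by rewrite /edge_form !at_vertex_rcons //; ring.
have -> : \sum_m al m * (at_vertex F (rcons S v) m i * at_vertex F (rcons S v) m j) =
   \sum_m al m * (at_vertex F S m i * at_vertex F S m j)
   + (i == ord0)%:R * (\sum_m al m * (at_vertex F S m v * at_vertex F S m j))
   + (j == ord0)%:R * (\sum_m al m * (at_vertex F S m i * at_vertex F S m v))
   + (i == ord0)%:R * (j == ord0)%:R *
     (\sum_m al m * (at_vertex F S m v * at_vertex F S m v)).
  rewrite !mulr_sumr -!big_split /=; apply: eq_bigr => m _.
  by rewrite !at_vertex_rcons //; ring.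
by rewrite /=; ring.
Qed.

Lemma lap_row_contracted S v c y al j : ord0 \in S -> v \in S -> v != ord0 ->
  lap S c y al v j = (j == v)%:R * c.
Proof.
move=> S0 Sv v0; rewrite mxE [v == j]eq_sym Sv v0 !andbT.
rewrite big1 ?big1; last 2 first.
- by move=> m _; rewrite (at_vertex_contracted m S0 Sv v0) mul0r mulr0.
- by move=> e _; rewrite /edge_form !(at_vertex_contracted _ S0 Sv v0); ring.
by rewrite mulr0 subr0 add0r mulrC.
Qed.

Definition joins S (e : cedge G) v :=
  (contract S (cend e false) = ord0 /\ contract S (cend e true) = v) \/
  (contract S (cend e false) = v /\ contract S (cend e true) = ord0).

Lemma joins_edge_form S e v r q i j : joins S e v ->
  edge_form S e r q i j =
  r * ((i == ord0)%:R * (j == v)%:R + (i == v)%:R * (j == ord0)%:R)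
  - q * ((i == ord0)%:R * (j == ord0)%:R + (i == v)%:R * (j == v)%:R) :> F.
Proof. by move=> [] [h0 h1]; rewrite /edge_form /at_vertex h0 h1; ring. Qed.

End Contraction.

Section Limits.
Context {K : numFieldType} {T : Type} {F : set_system T} {FF : Filter F}.

Lemma cvg_sums (I : Type) (r : seq I) (P : pred I) (f : I -> T -> K) (l : I -> K) :
  (forall i, P i -> f i t @[t --> F] --> l i) ->
  \sum_(i <- r | P i) f i t @[t --> F] --> \sum_(i <- r | P i) l i.
Proof.
move=> h; elim: r => [|i r IH].
  by rewrite big_nil; under eq_fun do rewrite big_nil; apply: cvg_cst.
rewrite big_cons; under eq_fun do rewrite big_cons; case Pi: (P i) => //.
by apply: cvgD => //; apply: h.
Qed.

Lemma cvg_prods (I : Type) (r : seq I) (f : I -> T -> K) (l : I -> K) :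
  (forall i, f i t @[t --> F] --> l i) ->
  \prod_(i <- r) f i t @[t --> F] --> \prod_(i <- r) l i.
Proof.
move=> h; elim: r => [|i r IH].
  by rewrite big_nil; under eq_fun do rewrite big_nil; apply: cvg_cst.
by rewrite big_cons; under eq_fun do rewrite big_cons; apply: cvgM.
Qed.

Lemma cvg_det n (A : T -> 'M[K]_n) (L : 'M[K]_n) :
  (forall i j, A t i j @[t --> F] --> L i j) ->
  \det (A t) @[t --> F] --> \det L.
Proof.
move=> h; apply: cvg_sums => s _; apply: cvgM; first exact: cvg_cst.
by apply: cvg_prods => i; apply: h.
Qed.

End Limits.

Section ContractionLimit.
Context {R : realType} {n : nat} {G : graph n.+1}.
Context {T : Type} {F : set_system T} {FF : Filter F}.

(** After merging, the contributions of [e] are multiples of [hop - stay = - (s - 1) / (s + 1)],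
    which tends to 0, except in the diagonal entry [v], where [- c stay] diverges. Multiplying row
    [v] by [s^2 - 1] turns this into [- c (s^2 + 1)], with limit [- 2 c], and makes the rest of the
    row tend to 0. The contracted matrix has [c] in that place: hence the factor [- 2]. *)
Lemma cvg_contraction (S : seq 'I_n.+1) (c : R) (y : cedge G -> R) al e v (s : T -> R) :
  ord0 \in S -> v \notin S -> joins S e v ->
  s t @[t --> F] --> (1 : R) -> (\forall t \near F, s t ^+ 2 != 1) ->
  (s t ^+ 2 - 1) * \det (lap S c [eta y with e |-> s t] al) @[t --> F] -->
  - 2 * \det (lap (rcons S v) c [eta y with e |-> 1] al).
Proof.
move=> S0 Sv he s1 sn1.
have v0 : v != ord0 by apply: contraNneq Sv => ->.
set B := merge_mx v (lap S c [eta y with e |-> 1] al).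
pose L : 'M[R]_n.+1 := \matrix_(i, j) if i == v then (j == v)%:R * (- 2 * c) else B i j.
have -> : - 2 * \det (lap (rcons S v) c [eta y with e |-> 1] al) = \det L.
  apply/esym; apply: (det_pinned (v := v) (x := c)) => [j|j|i j iv jv].
  - by rewrite mxE eqxx.
  - by rewrite lap_row_contracted // mem_rcons inE ?eqxx // S0 orbT.
  - by rewrite mxE (negPf iv) merge_lap.
(* The merged matrix with row [v] scaled, written so that only the denominator [s + 1] remains. *)
pose X t : 'M[R]_n.+1 := \matrix_(i, j)
  if i == v then (s t ^+ 2 - 1) * B v j
     - c * ((s t - 1) ^+ 2 * (j == ord0)%:R + (s t ^+ 2 + 1) * (j == v)%:R)
  else B i j - c * ((i == ord0)%:R * ((s t - 1) / (s t + 1)) * ((j == v)%:R + 2 * (j == ord0)%:R)).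
have XE t i j : X t i j = if i == v then (s t ^+ 2 - 1) * B v j
     - c * ((s t - 1) ^+ 2 * (j == ord0)%:R + (s t ^+ 2 + 1) * (j == v)%:R)
  else B i j - c * ((i == ord0)%:R * ((s t - 1) / (s t + 1)) * ((j == v)%:R + 2 * (j == ord0)%:R)).
  exact: mxE.
have eX : \forall t \near F,
    \det (X t) = (s t ^+ 2 - 1) * \det (lap S c [eta y with e |-> s t] al).
  apply: filterS sn1 => t; rewrite -subr_eq0 => h.
  have fac : s t ^+ 2 - 1 = (s t - 1) * (s t + 1) by ring.
  have /andP[h1 h2] : (s t - 1 != 0) && (s t + 1 != 0) by rewrite -negb_or -mulf_eq0 -fac.
  suff -> : X t = scale_row v (s t ^+ 2 - 1) (merge_mx v (lap S c [eta y with e |-> s t] al)).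
    by rewrite det_scale_row det_merge_mx.
  apply/matrixP => i j.
  rewrite XE scale_rowE.
  have -> : merge_mx v (lap S c [eta y with e |-> s t] al) i j = B i j + c *
      ((hop (s t) - stay (s t)) * ((i == ord0)%:R * (j == v)%:R + (i == v)%:R * (j == ord0)%:R
         + 2 * (i == ord0)%:R * (j == ord0)%:R) - stay (s t) * ((i == v)%:R * (j == v)%:R)).
    rewrite /B !merge_mxE !(lap_edge S c y al e (s t)).
    rewrite !(joins_edge_form _ _ _ _ he) !eqxx.
    rewrite ?[ord0 == v]eq_sym !(negPf v0).
    by case: (eqVneq i v) => [->|_]; case: (eqVneq j v) => [->|_]; rewrite ?(negPf v0) /=; ring.
  have [->|iv] := eqVneq i v; first by rewrite (negPf v0) /hop /stay /=; field.
  by rewrite mul1r /hop /stay fac /=; field; rewrite h1 h2.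
apply: cvg_trans (near_eq_cvg eX) _.
apply: cvg_det => i j; under eq_fun do rewrite XE.
case: (eqVneq i v) => [->|iv].
  rewrite [L v j]mxE eqxx.
  rewrite (_ : (j == v)%:R * _ = (1 ^+ 2 - 1) * B v j
     - c * ((1 - 1) ^+ 2 * (j == ord0)%:R + (1 ^+ 2 + 1) * (j == v)%:R)); last by ring.
  have s2 : s t ^+ 2 @[t --> F] --> (1 ^+ 2 : R) by rewrite expr2; apply: cvgM.
  have s12 : (s t - 1) ^+ 2 @[t --> F] --> ((1 - 1) ^+ 2 : R).
    by rewrite expr2; apply: cvgM; apply: cvgB => //; apply: cvg_cst.
  apply: cvgB; first by apply: cvgMl; apply: cvgB => //; apply: cvg_cst.
  by apply: cvgMr; apply: cvgD; apply: cvgMl => //; apply: cvgD => //; apply: cvg_cst.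
rewrite (_ : L i j = B i j - c * ((i == ord0)%:R * ((1 - 1) / (1 + 1))
    * ((j == v)%:R + 2 * (j == ord0)%:R))); last first.
  by rewrite mxE (negPf iv) subrr mul0r mulr0 mul0r mulr0 subr0.
apply: cvgB; first exact: cvg_cst.
apply: cvgMr; apply: cvgMl; apply: cvgMr; apply: cvgM.
  by apply: cvgB => //; apply: cvg_cst.
by apply: cvgV; [exact/lt0r_neq0/addr_gt0 | apply: cvgD => //; apply: cvg_cst].
Qed.

End ContractionLimit.

(** * Decay of the edge weights *)

Section ExponentialDecay.
Context {R : realType}.
Implicit Types (l : R).

Lemma cvg_invr_pinfty : x^-1 @[x --> +oo] --> (0 : R).
Proof.
apply/cvgrPdist_le => e e0; near=> x; rewrite sub0r normrN.
have x0 : 0 < e^-1 < x by rewrite invr_gt0 e0 /=; near: x; apply: nbhs_pinfty_gt; rewrite num_real.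
have /andP[ei ex] := x0; have xp : 0 < x := lt_trans ei ex.
rewrite gtr0_norm ?invr_gt0 // -[e]invrK lef_pV2 ?posrE // ?invr_gt0 //; exact: ltW.
Unshelve. all: by end_near. Qed.

Lemma cvg_mulr_expRN l : 0 < l -> x * expR (- (x * l)) @[x --> +oo] --> (0 : R).
Proof.
move=> l0; apply: (squeeze_cvgr (f := cst 0) (h := fun x : R => 2 / l ^+ 2 * x^-1)).
- near=> x; have x0 : 0 < x by near: x; apply: nbhs_pinfty_gt; rewrite num_real.
  have xl : 0 < x * l by apply: mulr_gt0.
  rewrite /cst /= mulr_ge0 ?expR_ge0 ?(ltW x0) //=.
  have := expR_ge1Dxn 1 (ltW xl); rewrite expRN => h.
  have h' : (x * l) ^+ 2 / 2 <= expR (x * l) by apply: le_trans h; rewrite lerDr.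
  have p2 : 0 < (x * l) ^+ 2 / 2 by rewrite divr_gt0 ?exprn_gt0.
  rewrite -lef_pV2 ?posrE ?expR_gt0 // in h'.
  apply: le_trans (ler_wpM2l (ltW x0) h') _.
  by rewrite le_eqVlt; apply/orP; left; apply/eqP; field; rewrite !gt_eqF.
- exact: cvg_cst.
- by rewrite -[X in _ --> X](mulr0 (2 / l ^+ 2)); apply: cvgMr; apply: cvg_invr_pinfty.
Unshelve. all: by end_near. Qed.

Lemma near_pinfty_neq0 : \forall x \near +oo, (x : R) != 0.
Proof.
near=> x; apply/lt0r_neq0; near: x; apply: nbhs_pinfty_gt; rewrite num_real //.
Unshelve. all: by end_near. Qed.

Lemma cvg_of_mulr (f : R -> R) (c : R) :
  x * (f x - c) @[x --> +oo] --> (0 : R) -> f x @[x --> +oo] --> c.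
Proof.
move=> h; rewrite -[c]addr0 -[X in _ + X](mul0r 0).
apply: (@cvg_trans _ (c + x^-1 * (x * (f x - c)) @[x --> +oo])).
  apply: near_eq_cvg; apply: filterS near_pinfty_neq0 => x x0.
  by rewrite mulrA mulVf // mul1r addrC subrK.
by apply: cvgD; [apply: cvg_cst | apply: cvgM h; apply: cvg_invr_pinfty].
Qed.

Lemma cvg_expRN_pinfty l : 0 < l -> expR (- (x * l)) @[x --> +oo] --> (0 : R).
Proof.
by move=> l0; apply: cvg_of_mulr; under eq_fun do rewrite subr0; apply: cvg_mulr_expRN.
Qed.

Lemma cvg_expRN_sqr l : 0 < l ->
  expR (- (x * l)) ^+ 2 - 1 @[x --> +oo] --> (- 1 : R).
Proof.
move=> l0; rewrite [X in _ --> X](_ : - 1 = 0 * 0 - 1 :> R); last by rewrite mulr0 sub0r.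
apply: cvgB; last exact: cvg_cst.
by under eq_fun do rewrite expr2; apply: cvgM; apply: cvg_expRN_pinfty.
Qed.

Lemma cvg_hop l : 0 < l -> x * hop (expR (- (x * l))) @[x --> +oo] --> (0 : R).
Proof.
move=> l0; rewrite [X in _ --> X](_ : 0 = 2 * 0 / (- 1) :> R); last by rewrite mulr0 mul0r.
rewrite (_ : (fun _ => _) = (fun x => 2 * (x * expR (- (x * l)))
    * (expR (- (x * l)) ^+ 2 - 1)^-1)); last first.
  by apply/funext => x; rewrite /hop; ring.
apply: cvgM; first by apply: cvgMr; apply: cvg_mulr_expRN.
by apply: cvgV; [rewrite oppr_eq0 oner_eq0 | apply: cvg_expRN_sqr].
Qed.

Lemma cvg_stay l : 0 < l -> x * (stay (expR (- (x * l))) - (- 1)) @[x --> +oo] --> (0 : R).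
Proof.
move=> l0; rewrite [X in _ --> X](_ : 0 = 2 * 0 * 0 / (- 1) :> R); last by rewrite mulr0 !mul0r.
apply: (@cvg_trans _ (2 * (x * expR (- (x * l))) * expR (- (x * l))
          * (expR (- (x * l)) ^+ 2 - 1)^-1 @[x --> +oo])).
  apply: near_eq_cvg; near=> x; rewrite /stay.
  have x0 : 0 < x by near: x; apply: nbhs_pinfty_gt; rewrite num_real.
  have h : expR (- (x * l)) ^+ 2 - 1 != 0.
    rewrite subr_eq0 lt_eqF // expr_lt1 ?expR_ge0 // expR_lt1 oppr_lt0.
    exact: mulr_gt0.
  by field.
apply: cvgM; first apply: cvgM; first by apply: cvgMr; apply: cvg_mulr_expRN.
  exact: cvg_expRN_pinfty.
by apply: cvgV; [rewrite oppr_eq0 oner_eq0 | apply: cvg_expRN_sqr].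
Unshelve. all: by end_near. Qed.

End ExponentialDecay.

(** * Asymptotics of the contracted matrix *)

Section PathLaplacian.
Context {R : realType} {n : nat} {G : graph n.+1}.
Implicit Types (p : seq (cedge G * bool)) (len : cedge G -> R) (a w : 'I_n.+1 -> R).
Implicit Types (i j m : 'I_n.+1) (tau : R).

Definition path_weight p len tau e : R :=
  if e \in walk_edges p then 1 else expR (- (tau * len e)).

(* The matrix M - kappa for k = i tau, after the edges of p have been contracted. *)
Definition path_lap p len al tau : 'M[R]_n.+1 :=
  lap (walk_vertices ord0 p) (- tau) (path_weight p len tau) al.

(** Limit of the diagonal entries divided by [- tau]: an end of an edge off the path counts 1, as
    [stay] tends to -1; a constant growing like [tau * w m] counts [w m]; the placeholder of a
    contracted vertex counts 1. The weights [w] will be 0 for the matrix without half-lines, and 1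
    at the external vertices for the one with them. *)
Definition free_degree p w i : R :=
  \sum_(e : cedge G) (if e \in walk_edges p then 0 else
     at_vertex R (walk_vertices ord0 p) (cend e false) i
     + at_vertex R (walk_vertices ord0 p) (cend e true) i)
  + \sum_m w m * at_vertex R (walk_vertices ord0 p) m i
  + ((i \in walk_vertices ord0 p) && (i != ord0))%:R.

Lemma at_vertex_sqr (F : fieldType) S m i :
  at_vertex F S m i * at_vertex F S m i = at_vertex F S m i.
Proof. by rewrite /at_vertex -natrM mulnb andbb. Qed.

Lemma at_vertex_neq (F : fieldType) S m i j : i != j ->
  at_vertex F S m i * at_vertex F S m j = 0.
Proof.
move=> ij; rewrite /at_vertex -natrM mulnb; case: eqP => // <-.
by rewrite eq_sym (negPf ij).
Qed.

Lemma at_vertex0 (F : fieldType) S m : ord0 \in S ->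
  at_vertex F S m ord0 = (m \in S)%:R.
Proof.
move=> S0; rewrite /at_vertex /contract; case: ifP => mS; first by rewrite eqxx.
by case: eqP mS => // <-; rewrite S0.
Qed.

Section Asymptotics.
Variables (p : seq (cedge G * bool)) (len : cedge G -> R) (a w : 'I_n.+1 -> R).
Hypothesis len_gt0 : forall e, 0 < len e.
Hypothesis w_ge0 : forall m, 0 <= w m.

Local Notation S := (walk_vertices ord0 p).
Local Notation A tau := (path_lap p len (fun m => a m + tau * w m) tau).
Local Notation hopw tau e := (hop (path_weight p len tau e)).
Local Notation stayw tau e := (stay (path_weight p len tau e)).
Local Notation at_ := (at_vertex R S).

Lemma root_in_walk : ord0 \in S. Proof. by rewrite inE eqxx. Qed.

Lemma cvg_hopw e : tau * hopw tau e @[tau --> +oo] --> (0 : R).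
Proof.
rewrite /path_weight; case: (e \in _); last exact: cvg_hop.
by under eq_fun do rewrite hop1 mulr0; apply: cvg_cst.
Qed.

Lemma cvg_stayw e :
  tau * (stayw tau e - (if e \in walk_edges p then 0 else - 1)) @[tau --> +oo] --> (0 : R).
Proof.
rewrite /path_weight; case: (e \in _); last exact: cvg_stay.
by under eq_fun do rewrite stay1 subr0 mulr0; apply: cvg_cst.
Qed.

Lemma cvg_hopw0 e : hopw tau e @[tau --> +oo] --> (0 : R).
Proof. by apply: cvg_of_mulr; under eq_fun do rewrite subr0; apply: cvg_hopw. Qed.

Lemma path_lap_offdiag i j : i != j -> A tau i j @[tau --> +oo] --> (0 : R).
Proof.
move=> ij.
have -> : 0 = - \sum_(e : cedge G) 0 * (at_ (cend e false) i * at_ (cend e true) j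
      + at_ (cend e true) i * at_ (cend e false) j) :> R.
  by rewrite big1 ?oppr0 // => e _; rewrite mul0r.
rewrite (_ : (fun _ => _) = (fun tau => - \sum_(e : cedge G) tau * hopw tau e *
    (at_ (cend e false) i * at_ (cend e true) j
      + at_ (cend e true) i * at_ (cend e false) j))); last first.
  apply/funext => tau; rewrite /path_lap mxE (negPf ij) mulr0 addr0.
  have -> : \sum_m (a m + tau * w m) * (at_ m i * at_ m j) = 0.
    by rewrite big1 // => m _; rewrite at_vertex_neq // mulr0.
  rewrite subr0.
  rewrite mulNr mulr_sumr; congr (- _); apply: eq_bigr => e _.
  by rewrite /edge_form !(at_vertex_neq _ _ _ ij) addr0 mulr0 subr0 mulrA.
apply: cvgN; apply: cvg_sums => e _; apply: cvgM; [exact: cvg_hopw | exact: cvg_cst].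
Qed.

Lemma path_lap_diag i :
  (- tau)^-1 * A tau i i @[tau --> +oo] --> free_degree p w i.
Proof.
apply: (@cvg_trans _ ((\sum_(e : cedge G) edge_form S e (hopw tau e) (stayw tau e) i i
   + \sum_m (a m * tau^-1 + w m) * at_ m i
   + ((i \in S) && (i != ord0))%:R) @[tau --> +oo])).
  apply: near_eq_cvg; apply: filterS near_pinfty_neq0 => tau tau0.
  rewrite /path_lap mxE eqxx /=.
  under [\sum_m (a m + _) * _]eq_bigr => m _ do rewrite at_vertex_sqr.
  have -> : \sum_m (a m * tau^-1 + w m) * at_ m i =
      tau^-1 * (\sum_m (a m + tau * w m) * at_ m i).
    by rewrite mulr_sumr; apply: eq_bigr => m _; field.
  by field.
apply: cvgD; last exact: cvg_cst.
apply: cvgD; apply: cvg_sums; last first.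
  move=> m _; apply: cvgM; last exact: cvg_cst.
  rewrite -[X in _ --> X]add0r -[X in X + w m](mulr0 (a m)); apply: cvgD; last exact: cvg_cst.
  by apply: cvgMr; apply: cvg_invr_pinfty.
move=> e _; rewrite /edge_form !at_vertex_sqr.
rewrite (_ : (if _ then _ else _) = 0 * (at_ (cend e false) i * at_ (cend e true) i
      + at_ (cend e true) i * at_ (cend e false) i) - (if e \in walk_edges p then 0 else - 1)
   * (at_ (cend e false) i + at_ (cend e true) i)); last by case: ifP => _; ring.
apply: cvgB; apply: cvgM; try exact: cvg_cst; first exact: cvg_hopw0.
by apply: cvg_of_mulr; apply: cvg_stayw.
Qed.

(** Off the path, [hop] and [stay + 1] decay exponentially, so they vanish even when multiplied by
    [tau]; beyond the linear term only the constants at the merged vertex remain. *)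
Lemma path_lap_corner :
  A tau ord0 ord0 + tau * free_degree p w ord0 @[tau --> +oo] -->
  - \sum_(m | m \in S) a m.
Proof.
have S0 := root_in_walk.
pose x (e : cedge G) : R := at_ (cend e false) ord0 * at_ (cend e true) ord0
      + at_ (cend e true) ord0 * at_ (cend e false) ord0.
pose y (e : cedge G) : R := at_ (cend e false) ord0 + at_ (cend e true) ord0.
have e0 : \sum_(e : cedge G) (0 * x e - 0 * y e) = 0.
  by rewrite big1 // => e _; rewrite !mul0r subr0.
rewrite (_ : - \sum_(m | m \in S) a m =
    - \sum_(e : cedge G) (0 * x e - 0 * y e) - \sum_(m | m \in S) a m); last first.
  by rewrite e0 oppr0 sub0r.
rewrite (_ : (fun _ => _) = (fun tau => - (\sum_(e : cedge G) (tau * hopw tau e * x e -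
    tau * (stayw tau e - (if e \in walk_edges p then 0 else - 1)) * y e))
    - \sum_(m | m \in S) a m)); last first.
  apply/funext => tau; rewrite /path_lap /free_degree mxE eqxx !andbF mulr0 !addr0.
  have -> : \sum_m (a m + tau * w m) * (at_ m ord0 * at_ m ord0) =
      \sum_(m | m \in S) a m + tau * \sum_m w m * at_ m ord0.
    rewrite [in RHS]big_mkcond [in RHS]mulr_sumr -[RHS]big_split; apply: eq_bigr => m _ /=.
    by rewrite at_vertex_sqr at_vertex0 //; case: (m \in _) => /=; ring.
  have -> : \sum_e (tau * hopw tau e * x e -
      tau * (stayw tau e - (if e \in walk_edges p then 0 else - 1)) * y e) =
      tau * (\sum_e edge_form S e (hopw tau e) (stayw tau e) ord0 ord0)
      - tau * (\sum_e (if e \in walk_edges p then 0 else y e)).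
    rewrite !mulr_sumr -sumrB; apply: eq_bigr => e _.
    by rewrite /edge_form !at_vertex_sqr /x /y; case: ifP => _; ring.
  by rewrite /y; ring.
apply: cvgB; last exact: cvg_cst.
apply: cvgN; apply: cvg_sums => e _; apply: cvgB; apply: cvgM; try exact: cvg_cst.
  exact: cvg_hopw.
exact: cvg_stayw.
Qed.

(** A contracted vertex has its placeholder. Any other vertex has, by connectedness, an edge towards
    the root, and this edge is off the path, which contains both ends of each of its edges. *)
Lemma free_degree_gt0 i l : connected_graph G -> walk ord0 p l -> i != ord0 ->
  0 < free_degree p w i.
Proof.
move=> hconn hp i0; rewrite /free_degree.
have w0 : 0 <= \sum_m w m * at_ m i by apply: sumr_ge0 => m _; rewrite mulr_ge0 ?ler0n.
have e0 : 0 <= \sum_(e : cedge G) (if e \in walk_edges p then 0 else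
     at_ (cend e false) i + at_ (cend e true) i).
  by apply: sumr_ge0 => e _; case: ifP => // _; rewrite addr_ge0 ?ler0n.
have [iS|iS] := boolP (i \in S).
  by rewrite i0 /= ltr_wpDl // addr_ge0.
rewrite addr0; apply: ltr_wpDr => //.
have [[|d q] /=] := hconn i ord0; first by rewrite (negPf i0).
move=> /andP[/eqP hd _].
have dp : d.1 \notin walk_edges p.
  by apply: contra iS => /(edge_ends_walk d.2 hp); rewrite -hd.
rewrite (bigD1 d.1) //= (negPf dp); apply: ltr_pwDl; last first.
  by apply: sumr_ge0 => e _; case: ifP => // _; rewrite addr_ge0 ?ler0n.
have hi : at_ (cend d.1 d.2) i = 1.
  rewrite (_ : cend _ _ = i) // /at_vertex /contract (negPf iS) eqxx //.
by move: hi; case: (d.2) => ->; [rewrite ltr_wpDl | rewrite ltr_wpDr]; rewrite ?ler0n ?ltr01.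
Qed.

Hypothesis hconn : connected_graph G.
Variable l : 'I_n.+1.
Hypothesis hp : walk ord0 p l.

(** The rescaled matrix tends to the diagonal matrix [D]. The root entry of [D] can be 0, as when
    [p] contains all the edges and [w = 0]; the corner cofactor omits this entry and so has a
    nonzero limit, while the determinant may not. *)
Let M tau := (- tau)^-1 *: A tau.
Let D : 'M[R]_n.+1 := diag_mx (\row_i free_degree p w i).

Let cvgMD i j : M tau i j @[tau --> +oo] --> D i j.
Proof.
have -> : D i j = free_degree p w i *+ (i == j) by rewrite !mxE.
under eq_fun do rewrite mxE.
have [<-|ij] := eqVneq i j; first exact: path_lap_diag.
have -> : free_degree p w i *+ false = - 0 * 0 by rewrite mulr0 mulr0n.
apply: cvgM; last exact: path_lap_offdiag.
under eq_fun do rewrite invrN; apply: cvgN; exact: cvg_invr_pinfty.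
Qed.

Let cvg_cofactor i j : cofactor (M tau) i j @[tau --> +oo] --> cofactor D i j.
Proof.
apply: cvgMr; apply: cvg_det => i' j'.
have minorE (B : 'M[R]_n.+1) : row' i (col' j B) i' j' = B (lift i i') (lift j j').
  by rewrite [LHS]mxE [LHS]mxE.
by rewrite minorE; under eq_fun do rewrite minorE; apply: cvgMD.
Qed.

Let cofactorD_gt0 : 0 < cofactor D ord0 ord0.
Proof.
rewrite /cofactor addn0 expr0 mul1r.
have -> : row' ord0 (col' ord0 D) = diag_mx (\row_i free_degree p w (lift ord0 i)).
  by apply/matrixP => i j; rewrite !mxE (inj_eq (@lift_inj _ _)).
rewrite det_diag; apply: prodr_gt0 => i _; rewrite mxE.
by apply: (free_degree_gt0 hconn hp); rewrite eq_sym neq_lift.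
Qed.

Let A_M tau : tau != 0 -> A tau = (- tau) *: M tau.
Proof. by move=> tau0; rewrite /M scalerA divff ?scale1r // oppr_eq0. Qed.

Lemma path_lap_cofactor_neq0 : \forall tau \near +oo, cofactor (A tau) ord0 ord0 != 0.
Proof.
have h : \forall tau \near +oo, cofactor (M tau) ord0 ord0 != 0.
  exact: cvgr_neq0 (@cvg_cofactor ord0 ord0) (lt0r_neq0 cofactorD_gt0).
apply: filterS2 h near_pinfty_neq0 => tau h tau0; rewrite A_M // cofactorZ mulf_neq0 //.
by rewrite expf_neq0 // oppr_eq0.
Qed.

Lemma path_lap_det_neq0 : 0 < w ord0 -> \forall tau \near +oo, \det (A tau) != 0.
Proof.
move=> w0; have D0 : \det D != 0.
  rewrite det_diag; apply/lt0r_neq0; apply: prodr_gt0 => i _; rewrite mxE.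
  have [->|i0] := eqVneq i ord0; last exact: (free_degree_gt0 hconn hp).
  rewrite /free_degree andbF addr0; apply: ltr_wpDl.
    by apply: sumr_ge0 => e _; case: ifP => // _; rewrite addr_ge0 ?ler0n.
  rewrite (bigD1 (ord0 : 'I_n.+1)) //= at_vertex0 ?root_in_walk // mulr1.
  by apply: ltr_pwDl => //; apply: sumr_ge0 => m _; rewrite mulr_ge0 ?ler0n.
have h : \forall tau \near +oo, \det (M tau) != 0.
  exact: cvgr_neq0 (cvg_det cvgMD) D0.
apply: filterS2 h near_pinfty_neq0 => tau h tau0; rewrite A_M // detZ mulf_neq0 //.
by rewrite expf_neq0 // oppr_eq0.
Qed.

(** Expansion along row 0 gives the corner entry plus the other entries of that row times quotients
    of cofactors. The quotients do not change under rescaling, hence converge, and the off-diagonal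
    entries tend to 0. *)
Lemma cvg_Schur :
  \det (A tau) / cofactor (A tau) ord0 ord0 + tau * free_degree p w ord0
    @[tau --> +oo] --> - \sum_(m | m \in S) a m.
Proof.
apply: (@cvg_trans _ ((A tau ord0 ord0 + tau * free_degree p w ord0)
  + \sum_(j | j != ord0) A tau ord0 j * (cofactor (M tau) ord0 j / cofactor (M tau) ord0 ord0)
   @[tau --> +oo])).
  apply: near_eq_cvg; apply: filterS2 path_lap_cofactor_neq0 near_pinfty_neq0 => tau h tau0.
  rewrite (expand_det_row _ ord0) [in RHS](bigD1 (ord0 : 'I_n.+1)) //= mulrDl mulfK //.
  rewrite mulr_suml [RHS]addrAC; congr (_ + _); apply: eq_bigr => j _.
  rewrite -[RHS]mulrA; congr (_ * _).
  move: h; rewrite A_M // !(cofactorZ (- tau)) mulf_eq0 negb_or => /andP[].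
  move: (cofactor _ ord0 ord0) (cofactor _ ord0 j) (_ ^+ _) => x y z z0 x0.
  by field; rewrite z0 x0.
have -> : - \sum_(m | m \in S) a m = - \sum_(m | m \in S) a m
    + \sum_(j | j != ord0) 0 * (cofactor D ord0 j / cofactor D ord0 ord0).
  by rewrite [X in _ = _ + X]big1 ?addr0 // => j _; rewrite mul0r.
apply: cvgD; first exact: path_lap_corner.
apply: cvg_sums => j j0; apply: cvgM; first by apply: path_lap_offdiag; rewrite eq_sym.
by apply: cvgM; [|apply: cvgV; [exact: lt0r_neq0 cofactorD_gt0|]]; apply: cvg_cofactor.
Qed.

End Asymptotics.
End PathLaplacian.

(** * Convergence on the Riemann sphere *)

Section ComplexTopology.
Context {R : realType}.

Lemma real_complex_continuous : continuous (fun x : R => x%:C : R[i]^o).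
Proof.
move=> x; apply/cvgrPdist_lt => e; rewrite ltcE /= => /andP[/eqP ei e0]; near=> y.
rewrite -rmorphB normc_def /= expr0n addr0 sqrtr_sqr ltcE /= ei eqxx /=.
by near: y; apply: cvgr_dist_lt.
Unshelve. all: by end_near. Qed.

Lemma Re_continuous : continuous (fun z : R[i]^o => complex.Re z : R).
Proof.
move=> z; have FF : Filter (nbhs (z : R[i]^o)) := nbhs_filter (z : R[i]^o).
apply/(@cvgrPdist_lt _ _ _ (nbhs (z : R[i]^o)) FF) => e e0.
have hb : nbhs (z : R[i]^o) (ball (z : R[i]^o) e%:C) by apply: nbhsx_ballx; rewrite ltcR.
apply: (@filterS _ (nbhs (z : R[i]^o)) FF _ _ _ hb) => w.
rewrite -ball_normE /= => h; rewrite -ltcR -ReB.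
exact: le_lt_trans (normc_ge_Re _) h.
Qed.

(** Where the cofactor is nonzero, [f_1] is the reciprocal of the finite number [det / cofactor];
    this map turns convergence of that real quotient into convergence on the sphere, also to
    infinity. *)
Definition sphere_of_inv (x : R) : Riemann_sphere R :=
  if x == 0 then None else Some (x^-1)%:C.

Lemma sphere_of_inv_continuous : continuous sphere_of_inv.
Proof.
move=> x; rewrite /continuous_at; have [x0|x0] := eqVneq x 0.
  have -> : sphere_of_inv x = None by rewrite /sphere_of_inv x0 eqxx.
  rewrite x0 {x x0}.
  (* A neighbourhood of infinity contains the complement of a compact set; real parts are bounded on
     that set, and reciprocals of small real numbers exceed the bound. *)
  move=> U hU; have [K [cK _] KU] : @one_point_nbhs (R[i]^o) None U by exact: hU.
  have cRe : compact [set complex.Re z | z in K].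
    by apply: continuous_compact cK; apply: continuous_subspaceT; exact: Re_continuous.
  have [M [_ hM]] := compact_bounded cRe; pose B := Num.max M 1 + 1.
  have MB : M < B by rewrite (@le_lt_trans _ _ (Num.max M 1)) ?le_max ?lexx // ltrDl.
  have B0 : 0 < B by rewrite addr_gt0 // lt_max ltr01 orbT.
  have : \forall y \near (0 : R), U (sphere_of_inv y).
    near=> y; apply: KU; rewrite /sphere_of_inv; case: eqP => y0; [by right | left].
    exists (y^-1)%:C => // yK.
    have := hM _ MB (complex.Re (y^-1)%:C) (imageP _ yK) => /=.
    apply/negP; rewrite -ltNge normfV -[B]invrK ltf_pV2 ?posrE ?invr_gt0 ?normr_gt0 //; last exact/eqP.
    rewrite -[y]opprK normrN -sub0r; near: y.
    by apply: (@cvgr_dist_lt _ _ _ (nbhs (0 : R))) => //; rewrite invr_gt0.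
  by [].
have -> : sphere_of_inv x = Some (x^-1)%:C by rewrite /sphere_of_inv (negPf x0).
apply: (@cvg_trans _ (Some (y^-1)%:C @[y --> x])).
  apply: near_eq_cvg; near=> y; rewrite /sphere_of_inv ifF //; apply/negbTE.
  by near: y; apply: (@cvgr_neq0 _ _ _ (nbhs x) _ id x) => //; exact: cvg_id.
apply: (@cvg_comp _ _ _ _ (@Some R[i]) _ (nbhs ((x^-1)%:C : R[i]^o))).
  apply: (@cvg_comp _ _ _ (fun y : R => y^-1) (fun y : R => y%:C : R[i]^o) _ (nbhs x^-1)).
    exact: cvgV.
  exact: real_complex_continuous.
by move=> U.
Unshelve. all: by end_near. Qed.

End ComplexTopology.

(** * The limit formula along a path *)

Section PathFormula.
Context {R : realType} {n : nat} {G : graph n.+1}.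
Implicit Types (p : seq (cedge G * bool)) (len : cedge G -> R) (al : 'I_n.+1 -> R).
Implicit Types (i j m : 'I_n.+1) (tau : R) (a : 'rV[R]_n.+1).

Lemma det_add_corner (F : comNzRingType) (A : 'M[F]_n.+1) x :
  \det (A + x *: delta_mx ord0 ord0) = \det A + x * cofactor A ord0 ord0.
Proof.
rewrite (expand_det_row _ ord0) (expand_det_row A ord0).
have cofE j : cofactor (A + x *: delta_mx ord0 ord0) ord0 j = cofactor A ord0 j.
  by congr (_ * \det _); apply/matrixP => i k; rewrite !mxE /= mulr0 addr0.
rewrite (bigD1 (ord0 : 'I_n.+1)) //= [in RHS](bigD1 (ord0 : 'I_n.+1)) //= cofE.
rewrite [X in _ + X](eq_bigr (fun j => A ord0 j * cofactor A ord0 j)).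
  by rewrite !mxE eqxx /=; ring.
by move=> j /negPf j0; rewrite cofE !mxE j0 mulr0 addr0.
Qed.

(** Lowering the constant at the root by 1 adds 1 to the corner entry, in which the determinant is
    affine with the cofactor as slope. *)
Lemma lap_cofactor (F : fieldType) S c (y : cedge G -> F) (al' : 'I_n.+1 -> F) : ord0 \in S ->
  cofactor (lap S c y al') ord0 ord0 =
  \det (lap S c y (fun m => al' m - (m == ord0)%:R)) - \det (lap S c y al').
Proof.
move=> S0; have -> : lap S c y (fun m => al' m - (m == ord0)%:R) =
    lap S c y (fun m => al' m - 1 * (m == ord0)%:R).
  by apply: eq_lap => // m; rewrite mul1r.
by rewrite lap_diag_shift // det_add_corner mul1r addrAC subrr add0r.
Qed.

Lemma invmx_corner (F : fieldType) (A : 'M[F]_n.+1) : A \in unitmx ->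
  invmx A ord0 ord0 = cofactor A ord0 ord0 / \det A.
Proof. by move=> hA; rewrite /invmx hA !mxE mulrC. Qed.

Lemma path_lap_eq p len al al' tau : al =1 al' ->
  path_lap p len al tau = path_lap p len al' tau.
Proof. exact: eq_lap. Qed.

Lemma Weyl_int_path_lap len a tau :
  Weyl_int len ('i * tau%:C) - kappa a =
  map_mx (real_complex R) (path_lap [::] len (a ord0) tau).
Proof.
rewrite Weyl_int_lap /path_lap map_lap mulrA mulcii mulN1r -rmorphN.
apply: eq_lap => // e; rewrite [RHS]/= /path_weight -(rmorphM (real_complex R)) mulNr.
by rewrite /cexp /= cos0 sin0 mulr1.
Qed.

Definition sphere_value (A : 'M[R]_n.+1) : Riemann_sphere R :=
  sphere_of_inv (\det A / cofactor A ord0 ord0).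

(** If the determinant vanishes, both sides are the point at infinity; the condition on the cofactor
    excludes the indeterminate case [0 / 0]. *)
Lemma f1_path_lap len a tau :
  cofactor (path_lap [::] len (a ord0) tau) ord0 ord0 != 0 ->
  f1 a ('i * tau%:C) len = sphere_value (path_lap [::] len (a ord0) tau).
Proof.
move=> h; rewrite /f1 Weyl_int_path_lap map_unitmx unitmxE unitfE /sphere_value /sphere_of_inv.
rewrite mulf_eq0 invr_eq0 (negPf h) orbF.
case: eqP => //= /eqP d0; rewrite -map_invmx mxE invmx_corner ?unitmxE ?unitfE //.
by rewrite invf_div.
Qed.

Lemma walk_vertices_rcons p d u :
  walk_vertices u (rcons p d) = rcons (walk_vertices u p) (ohead d).
Proof. by rewrite /walk_vertices map_rcons. Qed.

Section Step.
Variables (p : seq (cedge G * bool)) (d : cedge G * bool) (l : 'I_n.+1).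
Hypothesis hp : walk ord0 (rcons p d) l.
Hypothesis hu : uniq (walk_vertices ord0 (rcons p d)).

Lemma path_joins : joins (walk_vertices ord0 p) d.1 (ohead d).
Proof.
move: hp hu; rewrite walk_rcons walk_vertices_rcons rcons_uniq => /andP[h _] /andP[hd _].
have ht : contract (walk_vertices ord0 p) (otail d) = ord0.
  by rewrite /contract (mem_walk_end h).
have hh : contract (walk_vertices ord0 p) (ohead d) = ohead d.
  by rewrite /contract (negPf hd).
by move: ht hh; rewrite /otail /ohead /joins; case: (d.2) => /= -> ->; [right | left].
Qed.

Lemma path_edge_fresh : d.1 \notin walk_edges p.
Proof.
have := uniq_walk_edges hp hu.
by rewrite /walk_edges map_rcons rcons_uniq => /andP[].
Qed.

Lemma cvg_det_path_lap len al tau : 0 < tau ->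
  (expR (- (tau * t)) ^+ 2 - 1) * \det (path_lap p [eta len with d.1 |-> t] al tau)
    @[t --> 0^'+] --> - 2 * \det (path_lap (rcons p d) len al tau).
Proof.
move=> tau0; set y := path_weight p len tau.
have -> : path_lap (rcons p d) len al tau =
    lap (rcons (walk_vertices ord0 p) (ohead d)) (- tau) [eta y with d.1 |-> 1] al.
  rewrite /path_lap walk_vertices_rcons; apply: eq_lap => // e /=.
  rewrite /y /path_weight /walk_edges map_rcons mem_rcons inE.
  by case: (e == d.1).
under eq_fun => t.
  rewrite (_ : path_lap p _ al tau = lap (walk_vertices ord0 p) (- tau)
    [eta y with d.1 |-> expR (- (tau * t))] al); last first.
    apply: eq_lap => // e /=; rewrite /y /path_weight /=.
    by case: eqP => // ->; rewrite (negPf path_edge_fresh).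
  over.
apply: cvg_contraction.
- by rewrite inE eqxx.
- by move: hu; rewrite walk_vertices_rcons rcons_uniq => /andP[].
- exact: path_joins.
- have -> : 1 = expR (- (tau * 0)) :> R by rewrite mulr0 oppr0 expR0.
  apply: (cvg_at_right_filter (f := fun t : R => expR (- (tau * t)))).
  apply: continuous_cvg; first exact: continuous_expR.
  by apply: cvgN; apply: cvgMr; exact: cvg_id.
- near=> t; rewrite lt_eqF // expr_lt1 ?expR_ge0 // expR_lt1 oppr_lt0 mulr_gt0 //.
Unshelve. all: by end_near. Qed.

Lemma cvg_cofactor_path_lap len al tau : 0 < tau ->
  (expR (- (tau * t)) ^+ 2 - 1)
    * cofactor (path_lap p [eta len with d.1 |-> t] al tau) ord0 ord0
    @[t --> 0^'+] --> - 2 * cofactor (path_lap (rcons p d) len al tau) ord0 ord0.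
Proof.
move=> tau0; rewrite /path_lap lap_cofactor ?inE ?eqxx // mulrBr.
under eq_fun do rewrite lap_cofactor ?inE ?eqxx // mulrBr.
by apply: cvgB; apply: cvg_det_path_lap.
Qed.

End Step.

(** The last edge of the path belongs to the outermost limit, so the induction removes edges from
    the end. A nonzero cofactor for the contracted path forces nonzero ones for small lengths of the
    last edge, as the induction hypothesis requires. *)
Lemma path_iterated_lim a tau p l len : 0 < tau ->
  walk ord0 p l -> uniq (walk_vertices ord0 p) ->
  cofactor (path_lap p len (a ord0) tau) ord0 ord0 != 0 ->
  is_iterated_lim (f1 a ('i * tau%:C)) (rev (walk_edges p)) len
    (sphere_value (path_lap p len (a ord0) tau)).
Proof.
move=> tau0; elim/last_ind: p l len => [|p d IH] l len hp hu h.
  by rewrite /= f1_path_lap.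
rewrite {1}/walk_edges map_rcons rev_rcons /=.
exists (fun t => sphere_value (path_lap p [eta len with d.1 |-> t] (a ord0) tau)).
have h2 : - 2 * cofactor (path_lap (rcons p d) len (a ord0) tau) ord0 ord0 != 0.
  by rewrite mulf_neq0 // oppr_eq0.
have hc := @cvg_cofactor_path_lap p d l hp hu len (a ord0) tau tau0.
have hd := @cvg_det_path_lap p d l hp hu len (a ord0) tau tau0.
have hn : \forall t \near 0^'+, (expR (- (tau * t)) ^+ 2 - 1)
    * cofactor (path_lap p [eta len with d.1 |-> t] (a ord0) tau) ord0 ord0 != 0.
  exact: cvgr_neq0 hc h2.
have /andP[hp' _] : walk ord0 p (otail d) && (ohead d == l) by rewrite -walk_rcons.
have hu' : uniq (walk_vertices ord0 p).
  by move: hu; rewrite walk_vertices_rcons rcons_uniq => /andP[].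
split.
  apply: filterS hn => t; rewrite mulf_eq0 negb_or => /andP[_].
  exact: IH hp' hu'.
rewrite /sphere_value; apply: (continuous_cvg _ (@sphere_of_inv_continuous R _)).
have n2 : - 2 != 0 :> R by rewrite oppr_eq0.
rewrite -[X in _ --> X]mul1r -[X in X * _](divff n2) mulf_div.
apply: cvg_trans (cvgM hd (cvgV h2 hc)).
apply: near_eq_cvg; apply: filterS hn => t; rewrite mulf_eq0 negb_or => /andP[s0 _] /=.
by rewrite -mulf_div divff // mul1r.
Qed.

(** Both ends of every path edge lie at vertices of the path, and there is one edge less than there
    are vertices: these ends make up the subtracted term. *)
Lemma free_degree0 p l : walk ord0 p l -> uniq (walk_vertices ord0 p) ->
  free_degree p (fun=> 0) ord0 =
  (\sum_(m | m \in walk_vertices ord0 p) deg (compact_part G) m)%N%:R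
    - 2 * ((size (walk_vertices ord0 p))%:R - 1) :> R.
Proof.
move=> hp hu; set S := walk_vertices ord0 p.
have S0 : ord0 \in S by rewrite inE eqxx.
have ends : (\sum_(m | m \in S) deg (compact_part G) m)%N%:R =
    \sum_(e : cedge G) ((cend e false \in S)%:R + (cend e true \in S)%:R) :> R.
  rewrite natr_sum.
  transitivity (\sum_(x : cedge G * bool) (cend x.1 x.2 \in S)%:R : R); last first.
    rewrite -(pair_big predT predT (fun e b => (cend e b \in S)%:R : R)) /=.
    by apply: eq_bigr => e _; rewrite big_bool /= addrC.
  transitivity (\sum_(m | m \in S) \sum_(x : cedge G * bool) (cend x.1 x.2 == m)%:R : R).
    apply: eq_bigr => m _; rewrite /deg [X in (_ + X)%N](_ : _ = 0%N) ?addn0; last first.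
      by apply: eq_card0 => -[].
    rewrite -sum1_card natr_sum big_mkcond /=; apply: eq_bigr => x _.
    rewrite (_ : (x \in _) = (cend x.1 x.2 == m)); last by apply/idP/idP; rewrite inE.
    by case: (_ == _).
  rewrite exchange_big /=; apply: eq_bigr => x _.
  have [xS|xS] := boolP (cend x.1 x.2 \in S).
    rewrite (bigD1 (cend x.1 x.2)) //= eqxx big1 ?addr0 // => m /andP[_ /negPf].
    by rewrite eq_sym => ->.
  by rewrite big1 // => m mS; case: eqP => // xm; move: xS; rewrite xm mS.
have path_ends : \sum_(e : cedge G) (if e \in walk_edges p then 2 else 0) =
    2 * ((size S)%:R - 1) :> R.
  rewrite -big_mkcond /= sumr_const (card_uniqP (uniq_walk_edges hp hu)).
  by rewrite /S /= !size_map -[(size p).+1%:R]natr1 addrK mulr_natr.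
rewrite ends -path_ends /free_degree andbF addr0 [X in _ + X = _]big1 ?addr0; last first.
  by move=> m _; rewrite mul0r.
rewrite -sumrB; apply: eq_bigr => e _; rewrite !at_vertex0 //.
case: ifP => he; last by rewrite subr0.
by rewrite !(edge_ends_walk _ hp he) subrr.
Qed.

Lemma path_formulaP len a p l : (forall e, 0 < len e) -> connected_graph G ->
  walk ord0 p l -> uniq (walk_vertices ord0 p) ->
  path_formula a len p (\sum_(m | m \in walk_vertices ord0 p) a ord0 m).
Proof.
move=> hlen hconn hp hu.
have al0 tau : (fun m => a ord0 m + tau * 0) =1 a ord0 by move=> m; rewrite mulr0 addr0.
have hcof : \forall tau \near +oo, cofactor (path_lap p len (a ord0) tau) ord0 ord0 != 0.
  have := path_lap_cofactor_neq0 (a ord0) hlen (w := fun=> 0) (fun=> lexx 0) hconn hp.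
  by apply: filterS => tau; rewrite (path_lap_eq _ _ _ (al0 tau)).
exists (fun tau => sphere_value (path_lap p len (a ord0) tau)); split.
  near=> tau; split.
    apply: path_iterated_lim hp hu _; last by near: tau.
    by near: tau; apply: nbhs_pinfty_gt; rewrite num_real.
  rewrite /sphere_value /sphere_of_inv; case: eqP => // /eqP h [] /eqP.
  by rewrite invr_eq0 (negPf h).
pose h tau := - (\det (path_lap p len (a ord0) tau)
    / cofactor (path_lap p len (a ord0) tau) ord0 ord0
    + tau * free_degree p (fun=> 0) ord0).
(* This covers infinite values too: [sphere_inv] is 0 there, and so is the quotient of the
   determinant by the cofactor. *)
have hE tau : (- tau * free_degree p (fun=> 0) ord0)%:C
    - sphere_inv (sphere_value (path_lap p len (a ord0) tau)) = (h tau)%:C.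
  rewrite /h /sphere_value /sphere_of_inv opprD rmorphD /= mulNr addrC; congr (_ + _).
  rewrite rmorphN; congr (- _); case: eqP => [->|_] //=.
  by rewrite [X in X^-1]fmorphV invrK.
rewrite /= -(free_degree0 hp hu); under eq_fun do rewrite hE.
apply: (@cvg_comp _ _ _ h (fun x : R => x%:C : R[i]^o)); last exact: real_complex_continuous.
have := @cvg_Schur _ _ _ p len (a ord0) (fun=> 0) hlen (fun=> lexx 0) hconn l hp.
under eq_fun do rewrite (path_lap_eq _ _ _ (al0 _)).
by move=> /cvgN; rewrite opprK.
Unshelve. all: by end_near. Qed.

End PathFormula.

(** * Exponential polynomials and their zero test *)

Section ExponentialIndependence.
Context {R : realType} (I : eqType) (E : I -> R -> R[i]).
Implicit Types (p : I -> {poly R[i]}) (A : seq I) (t h : R).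
Hypothesis E_shift : forall i t h, E i (t + h) = E i t * E i h.
Hypothesis E_neq0 : forall i t, E i t != 0.

Lemma poly_vanishing_ray (q : {poly R[i]}) :
  (forall t, 0 < t -> q.['i * t%:C] = 0) -> q = 0.
Proof.
move=> hq; apply: contraTeq isT => q0.
pose s := [seq 'i * (j.+1%:R : R)%:C | j <- iota 0 (size q)].
have := @max_poly_roots _ q s q0; rewrite size_map size_iota ltnn; apply.
  by apply/allP => x /mapP[j _ ->]; apply/rootP/hq; rewrite ltr0n.
rewrite map_inj_uniq ?iota_uniq // => j k /(mulfI (@imag_neq0 R)) /complexI /eqP.
by rewrite eqr_nat => /eqP[].
Qed.

Lemma coef_top_shift (F : idomainType) (q : {poly F}) a :
  (q \Po ('X + a%:P))`_(size q).-1 = q`_(size q).-1.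
Proof.
have sX : size ('X + a%:P : {poly F}) = 2 by rewrite size_XaddC.
rewrite -{1}(size_comp_poly2 q sX) -[LHS]/(lead_coef _) lead_coef_comp ?sX //.
by rewrite lead_coefXaddC expr1n mulr1.
Qed.

(* With w = E i h, subtracting w times the relation from its shift by h lowers
   the degree of p i and keeps the degree of p j whenever E j h <> w. *)
Lemma exponential_polynomials_independent A p :
  {in A &, forall i j, i != j -> exists2 h, 0 < h & E i h != E j h} -> uniq A ->
  (forall t, 0 < t -> \sum_(i <- A) (p i).['i * t%:C] * E i t = 0) ->
  {in A, forall i, p i = 0}.
Proof.
move=> hE uA; move eN: (\sum_(i <- A) size (p i))%N => N.
elim/ltn_ind: N p eN => N IH p eN hp i iA; apply/eqP; apply: contraT => pi0.
have [/hasP[j jA /andP[ji pj0]]|/hasPn no] :=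
    boolP (has (fun j => (j != i) && (p j != 0)) A); last first.
  case/eqP: pi0; apply: poly_vanishing_ray => t t0.
  have := hp t t0; rewrite (bigD1_seq i) //= big_seq_cond big1 ?addr0.
    by move/eqP; rewrite mulf_eq0 (negPf (E_neq0 _ _)) orbF => /eqP.
  move=> j /andP[/no]; rewrite negb_and negbK => /orP[->//|/negPn/eqP -> _].
  by rewrite horner0 mul0r.
have [h h0 hw] := hE j i jA iA ji.
pose p' k := E k h *: (p k \Po ('X + ('i * h%:C)%:P)) - E i h *: p k.
have top k : (p' k)`_(size (p k)).-1 = (E k h - E i h) * lead_coef (p k).
  by rewrite coefB !coefZ coef_top_shift -mulrBl.
have sz k : (size (p' k) <= size (p k))%N.
  rewrite (leq_trans (size_polyD _ _)) // size_polyN geq_max !(leq_trans (size_scale_leq _ _)) //.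
  by rewrite size_comp_poly2 // size_XaddC.
have szi : (size (p' i) < size (p i))%N.
  have si : (0 < size (p i))%N by rewrite size_poly_gt0.
  rewrite -[ltnRHS](prednK si) ltnS; apply/leq_sizeP => m.
  rewrite leq_eqVlt => /orP[/eqP <-|hm]; first by rewrite top subrr mul0r.
  by move: (sz i) => /leq_sizeP; apply; rewrite -(prednK si).
have lt : (\sum_(k <- A) size (p' k) < N)%N.
  rewrite -eN (bigD1_seq i) //= [ltnRHS](bigD1_seq i) //= -addSn leq_add //.
  by apply: leq_sum => k _.
have hp' t : 0 < t -> \sum_(k <- A) (p' k).['i * t%:C] * E k t = 0.
  move=> t0; have := hp (t + h) (addr_gt0 t0 h0).
  have -> : \sum_(k <- A) (p' k).['i * t%:C] * E k t =
    \sum_(k <- A) (p k).['i * (t + h)%:C] * E k (t + h)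
    - E i h * \sum_(k <- A) (p k).['i * t%:C] * E k t.
    rewrite mulr_sumr -sumrB; apply: eq_bigr => k _.
    rewrite E_shift /p' !hornerE horner_comp !hornerE rmorphD /= mulrDr; ring.
  by rewrite (hp t t0) mulr0 subr0.
have /eqP := IH _ lt p' erefl hp' j jA; apply: contraTT => _.
apply/negP => /eqP pj'; have := top j; rewrite pj' coef0 => /esym/eqP.
by rewrite mulf_eq0 subr_eq0 (negPf hw) lead_coef_eq0 (negPf pj0).
Qed.

End ExponentialIndependence.

Section ExponentialPolynomials.
Variables (F : comNzRingType) (X : finType).
Implicit Types (f g : F -> (X -> F) -> F) (c : F) (y : X -> F).

(* Polynomials in c and the y e; the substitution c = i k, y e = exp (i k l_e)
   makes them exponential polynomials in k. *)
Definition expoly f := exists s : seq ({poly F} * {ffun X -> nat}),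
  forall c y, f c y = \sum_(t <- s) t.1.[c] * \prod_e y e ^+ t.2 e.

Lemma eq_expoly f g : (forall c y, f c y = g c y) -> expoly f -> expoly g.
Proof. by move=> fg [s hs]; exists s => c y; rewrite -fg. Qed.

Lemma expoly_poly (q : {poly F}) : expoly (fun c _ => q.[c]).
Proof.
exists [:: (q, [ffun=> 0%N])] => c y; rewrite big_seq1 big1 ?mulr1 // => e _.
by rewrite ffunE.
Qed.

Lemma expoly_cst x : expoly (fun _ _ => x).
Proof. by apply: eq_expoly (expoly_poly x%:P) => c y; rewrite hornerC. Qed.

Lemma expoly_id : expoly (fun c _ => c).
Proof. by apply: eq_expoly (expoly_poly 'X) => c y; rewrite hornerX. Qed.

Lemma expoly_var e : expoly (fun _ y => y e).
Proof.
exists [:: (1, [ffun x => (x == e) : nat])] => c y; rewrite big_seq1 hornerC mul1r.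
rewrite (bigD1 e) //= ffunE eqxx expr1 big1 ?mulr1 // => x /negPf xe.
by rewrite ffunE xe.
Qed.

Lemma expolyD f g : expoly f -> expoly g -> expoly (fun c y => f c y + g c y).
Proof. by move=> [s hs] [r hr]; exists (s ++ r) => c y; rewrite hs hr big_cat. Qed.

Lemma expolyM f g : expoly f -> expoly g -> expoly (fun c y => f c y * g c y).
Proof.
move=> [s hs] [r hr].
exists (allpairs (fun t u : {poly F} * {ffun X -> nat} =>
  (t.1 * u.1, [ffun x => (t.2 x + u.2 x)%N])) s r) => c y.
rewrite hs hr big_allpairs_dep /= mulr_suml; apply: eq_bigr => t _.
rewrite mulr_sumr; apply: eq_bigr => u _; rewrite hornerM mulrACA -big_split /=.
by congr (_ * _); apply: eq_bigr => e _; rewrite ffunE exprD.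
Qed.

Lemma expolyB f g : expoly f -> expoly g -> expoly (fun c y => f c y - g c y).
Proof.
move=> hf hg; apply: eq_expoly (expolyD hf (expolyM (expoly_cst (-1)) hg)) => c y.
by rewrite mulN1r.
Qed.

Lemma expoly_sum (J : Type) (r : seq J) (P : pred J) (f : J -> F -> (X -> F) -> F) :
  (forall j, P j -> expoly (f j)) -> expoly (fun c y => \sum_(j <- r | P j) f j c y).
Proof.
move=> h; elim: r => [|j r IH].
  by apply: eq_expoly (expoly_cst 0) => c y; rewrite big_nil.
apply: (eq_expoly (f := fun c y => (if P j then f j c y else 0) + \sum_(j <- r | P j) f j c y)).
  by move=> c y; rewrite big_cons; case: (P j); rewrite ?add0r.
by apply: expolyD IH; case Pj: (P j); [apply: h | apply: expoly_cst].
Qed.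

Lemma expoly_prod (J : Type) (r : seq J) (P : pred J) (f : J -> F -> (X -> F) -> F) :
  (forall j, P j -> expoly (f j)) -> expoly (fun c y => \prod_(j <- r | P j) f j c y).
Proof.
move=> h; elim: r => [|j r IH].
  by apply: eq_expoly (expoly_cst 1) => c y; rewrite big_nil.
apply: (eq_expoly (f := fun c y => (if P j then f j c y else 1) * \prod_(j <- r | P j) f j c y)).
  by move=> c y; rewrite big_cons; case: (P j); rewrite ?mul1r.
by apply: expolyM IH; case Pj: (P j); [apply: h | apply: expoly_cst].
Qed.

Lemma expoly_det n (A : F -> (X -> F) -> 'M[F]_n) :
  (forall i j, expoly (fun c y => A c y i j)) -> expoly (fun c y => \det (A c y)).
Proof.
move=> h; apply: expoly_sum => s _; apply: expolyM; first exact: expoly_cst.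
by apply: expoly_prod => i _.
Qed.

End ExponentialPolynomials.

Section ZeroTest.
Context {R : realType} {X : finType}.
Variable len : X -> R.
Implicit Types (k : R) (al : {ffun X -> nat}).

Definition frequency al : R := \sum_e (al e)%:R * len e.

Lemma frequency_inj : rationally_independent len -> injective frequency.
Proof.
move=> hr al be hab; apply/ffunP => e.
have := hr (fun e => (al e)%:R - (be e)%:R).
move=> /(_ _ e) h; apply/eqP; rewrite -(eqr_nat rat) -subr_eq0; apply/eqP/h.
under eq_bigr => x _ do rewrite rmorphB !rmorph_nat mulrBl.
by rewrite sumrB -/(frequency al) -/(frequency be) hab subrr.
Qed.

Lemma cexp_sum (J : finType) (x : J -> R[i]) : cexp (\sum_j x j) = \prod_j cexp (x j).
Proof. exact: (big_morph _ (@cexpD R) (@cexp0 R)). Qed.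

Lemma cexpMn (x : R[i]) m : cexp (x *+ m) = cexp x ^+ m.
Proof.
by elim: m => [|m IH]; rewrite ?mulr0n ?cexp0 ?expr0 // mulrS exprS cexpD IH.
Qed.

Lemma cexp_imag (x : R) : cexp ('i * x%:C) = cos x +i* sin x.
Proof.
rewrite /cexp /= !mul0r mul1r !subr0 expR0; apply/eqP.
by rewrite eq_complex /= !mul1r !mul0r subr0 addr0 add0r !eqxx.
Qed.

(** Equal monomials are collected; distinct ones have distinct frequencies, so each collected
    coefficient is the zero polynomial. This makes [c] and all the [y e] independent variables,
    although only the real parameter [k] was given. *)
Lemma expoly_eq0 (f : R[i] -> (X -> R[i]) -> R[i]) : rationally_independent len ->
  expoly f ->
  (forall k, 0 < k -> f ('i * k%:C) (fun e => cexp ('i * k%:C * (len e)%:C)) = 0) ->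
  forall c y, f c y = 0.
Proof.
move=> hr [s hs] h0 c y.
pose A := undup [seq t.2 | t <- s].
pose q al := \sum_(t <- s | t.2 == al) t.1.
pose E al k := cexp ('i * (k * frequency al)%:C).
have fE c' y' : f c' y' = \sum_(al <- A) (q al).[c'] * \prod_e y' e ^+ al e.
  rewrite hs; under [RHS]eq_bigr => al _ do rewrite horner_sum mulr_suml big_mkcond.
  rewrite exchange_big /= big_seq [RHS]big_seq; apply: eq_bigr => t ts.
  rewrite (bigD1_seq t.2) ?undup_uniq ?mem_undup ?map_f //= eqxx [X in _ + X]big1 ?addr0 //.
  by move=> al; rewrite eq_sym => /negPf ->.
have EE al k : \prod_e cexp ('i * k%:C * (len e)%:C) ^+ al e = E al k.
  under eq_bigr => e _ do rewrite -cexpMn; rewrite -cexp_sum /E; congr cexp.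
  rewrite /frequency mulr_sumr rmorph_sum mulr_sumr; apply: eq_bigr => e _.
  by rewrite !rmorphM rmorph_nat -mulr_natr; ring.
have qA : {in A, forall al, q al = 0}.
  apply: (@exponential_polynomials_independent R _ E) => [al t h|al t|al be _ _ ab||t t0].
  - by rewrite /E mulrDl rmorphD mulrDr cexpD.
  - exact: cexp_neq0.
  - have d0 : frequency al - frequency be != 0.
      by rewrite subr_eq0 (inj_eq (frequency_inj hr)).
    (* For this shift the quotient of the two exponentials is -1, hence not 1. *)
    exists (pi / `|frequency al - frequency be|); first by rewrite divr_gt0 ?pi_gt0 ?normr_gt0.
    set h := pi / _; apply/eqP => hE.
    have : E al h / E be h = 1 by rewrite hE divff // cexp_neq0.
    rewrite /E -cexpN -cexpD -mulrBr -rmorphB -mulrBr cexp_imag => /eqP.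
    rewrite eq_complex /= => /andP[/eqP + _].
    have -> : cos (h * (frequency al - frequency be)) = -1.
      rewrite /h; case: (lerP 0 (frequency al - frequency be)) => hd.
        by rewrite ger0_norm // divfK // cospi.
      by rewrite ltr0_norm // invrN mulrN mulNr divfK // cosN cospi.
    by lra.
  - exact: undup_uniq.
  - by rewrite -[RHS](h0 t t0) fE; apply: eq_bigr => al _; rewrite EE.
by rewrite fE big_seq big1 // => al /qA ->; rewrite horner0 mul0r.
Qed.

End ZeroTest.

(** * Clearing denominators *)

Section ClearedLaplacian.
Context {F : fieldType} {n : nat} {G : graph n.+1}.
Implicit Types (S : seq 'I_n.+1) (c : F) (y : cedge G -> F) (x z : 'I_n.+1 -> F).

Definition lap_den y := \prod_e (y e ^+ 2 - 1).

(** [lap] times the common denominator, polynomial in [c] and [y]. The constants are affine in [c]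
    because the half-line term [i k P_ext] amounts to a shift by [- c] at the external vertices. *)
Definition cleared_lap S x z c y : 'M[F]_n.+1 := \matrix_(i, j)
  (c * (\sum_e edge_form S e (2 * y e * \prod_(e' | e' != e) (y e' ^+ 2 - 1))
          ((y e ^+ 2 + 1) * \prod_(e' | e' != e) (y e' ^+ 2 - 1)) i j)
   - lap_den y * (\sum_m (x m + c * z m) * (at_vertex F S m i * at_vertex F S m j))
   + lap_den y * (c * [&& i == j, i \in S & i != ord0]%:R)).

Lemma cleared_lapE S x z c y : lap_den y != 0 ->
  cleared_lap S x z c y = lap_den y *: lap S c y (fun m => x m + c * z m).
Proof.
move=> hd; apply/matrixP => i j; rewrite !mxE mulrDr mulrBr; congr (_ - _ + _).
rewrite mulrCA; congr (_ * _); rewrite mulr_sumr; apply: eq_bigr => e _.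
have de : lap_den y = (y e ^+ 2 - 1) * \prod_(e' | e' != e) (y e' ^+ 2 - 1).
  by rewrite /lap_den (bigD1 e).
have he : y e ^+ 2 - 1 != 0 by apply: contra_neq hd => h; rewrite de h mul0r.
by rewrite de /edge_form /hop /stay; move: (\prod_(_ | _) _) => Q; field.
Qed.

Lemma det_cleared_lap S x z c y : lap_den y != 0 ->
  \det (cleared_lap S x z c y) =
  lap_den y ^+ n.+1 * \det (lap S c y (fun m => x m + c * z m)).
Proof. by move=> hd; rewrite cleared_lapE // detZ. Qed.

Lemma expoly_lap_den : expoly (fun (_ : F) y => lap_den y).
Proof.
apply: expoly_prod => e _; apply: expolyB; last exact: expoly_cst.
by apply: (eq_expoly (f := fun _ y => y e * y e)) => //; apply: expolyM; apply: expoly_var.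
Qed.

Lemma expoly_det_cleared_lap S x z :
  expoly (fun c y => \det (cleared_lap S x z c y)).
Proof.
have hQ (e : cedge G) : expoly (fun (_ : F) y => \prod_(e' | e' != e) (y e' ^+ 2 - 1)).
  apply: expoly_prod => e' _; apply: expolyB; last exact: expoly_cst.
  by apply: (eq_expoly (f := fun _ y => y e' * y e')) => //; apply: expolyM; apply: expoly_var.
apply: expoly_det => i j.
apply: (eq_expoly (f := fun c y =>
  c * (\sum_e edge_form S e (2 * y e * \prod_(e' | e' != e) (y e' ^+ 2 - 1))
          ((y e * y e + 1) * \prod_(e' | e' != e) (y e' ^+ 2 - 1)) i j)
   - lap_den y * (\sum_m (x m + c * z m) * (at_vertex F S m i * at_vertex F S m j))
   + lap_den y * (c * [&& i == j, i \in S & i != ord0]%:R))).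
  by move=> c y; rewrite mxE.
apply: expolyD; last first.
  by apply: expolyM; [exact: expoly_lap_den | apply: expolyM; [exact: expoly_id | exact: expoly_cst]].
apply: expolyB; last first.
  apply: expolyM; first exact: expoly_lap_den.
  apply: expoly_sum => m _; apply: expolyM; last exact: expoly_cst.
  by apply: expolyD; [exact: expoly_cst | apply: expolyM; [exact: expoly_id | exact: expoly_cst]].
apply: expolyM; first exact: expoly_id.
apply: expoly_sum => e _; apply: expolyB; apply: expolyM; try exact: expoly_cst.
  by apply: expolyM => //; apply: expolyM; [exact: expoly_cst | exact: expoly_var].
apply: expolyM => //; apply: expolyD; last exact: expoly_cst.
by apply: expolyM; apply: expoly_var.
Qed.

(** The substitution is [k -> - k], and [k cot (k l)] and [k / sin (k l)] are even. For real [k] it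
    is also complex conjugation of [c] and [y], so with real constants the matrix without half-lines
    is Hermitian. *)
Lemma lap_inv c y al : (forall e, y e != 0) ->
  lap [:: ord0] (- c) (fun e => (y e)^-1) al = lap [:: ord0] c y al.
Proof.
move=> y0; apply/matrixP => i j; rewrite !lap_set1E; congr (_ - _).
rewrite mulNr -mulrN -sumrN; congr (_ * _); apply: eq_bigr => e _.
have [h|h] := eqVneq (y e ^+ 2) 1.
  by rewrite /edge_form /hop /stay exprVn h invr1 subrr invr0 !mulr0 !mul0r subrr oppr0.
have h1 : y e ^+ 2 - 1 != 0 by rewrite subr_eq0.
have h2 : 1 - y e ^+ 2 != 0 by rewrite subr_eq0 eq_sym.
by rewrite /edge_form /hop /stay; have := y0 e => ye0; field; rewrite ye0 h1 mulN1r h2.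
Qed.

End ClearedLaplacian.

(** * From the scattering matrix to determinants *)

Section Scattering.
Context {R : realType} {n : nat} {G : graph n.+1}.
Implicit Types (len : cedge G -> R) (a : 'rV[R]_n.+1) (k s : R).

Local Notation ext m := ((external G m)%:R : R[i]).
Local Notation cc k := ('i * k%:C : R[i]).
Local Notation ww len k := (fun e => cexp (cc k * (len e)%:C)).

Lemma lap_add_diag c (y : cedge G -> R[i]) al b :
  lap [:: ord0] c y (fun m => al m - b * ext m) = lap [:: ord0] c y al + b *: P_ext G.
Proof.
apply/matrixP => i j; rewrite [RHS]mxE !lap_set1E !mxE.
by have [<-|ij] := eqVneq i j; rewrite ?mulr1n ?mulr0n; ring.
Qed.

Lemma sqrtC_sqr k : 0 < k -> sqrtC (k ^+ 2)%:C = k%:C.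
Proof. by move=> k0; rewrite rmorphXn sqrCK // ler0c ltW. Qed.

Lemma Weyl_lap len a k : 0 < k ->
  Weyl len (k ^+ 2)%:C - kappa a =
  lap [:: ord0] (cc k) (ww len k) (fun m => (a ord0 m)%:C - cc k * ext m).
Proof.
by move=> k0; rewrite lap_add_diag -Weyl_int_lap /Weyl sqrtC_sqr // addrAC.
Qed.

Lemma kappa0 : kappa (0 : 'rV[R]_n.+1) = 0.
Proof. by apply/matrixP => i j; rewrite !mxE mul0rn. Qed.

Lemma conj_imag k : (cc k)^* = - cc k.
Proof. by apply/eqP; rewrite eq_complex /=; apply/andP; split; apply/eqP; ring. Qed.

Lemma conj_cexp_imag k (l : R) : (cexp (cc k * l%:C))^* = (cexp (cc k * l%:C))^-1.
Proof.
rewrite -cexpN -mulrA -rmorphM -mulrN -rmorphN !cexp_imag cosN sinN.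
by apply/eqP; rewrite eq_complex /= !eqxx.
Qed.

Lemma lap_adjoint len k al :
  (lap [:: ord0] (cc k) (ww len k) al) ^t* =
  lap [:: ord0] (cc k) (ww len k) (fun m => (al m)^*).
Proof.
rewrite tr_lap (map_lap Num.conj) -[RHS]lap_inv; last by move=> e; apply: cexp_neq0.
by rewrite -conj_imag; apply: eq_lap => // e /=; apply: conj_cexp_imag.
Qed.

(** For real [k] only the half-line term is not self-adjoint: taking the adjoint changes its
    sign. *)
Lemma Weyl_adjoint len a k : 0 < k ->
  (Weyl len (k ^+ 2)%:C) ^t* - kappa a =
  lap [:: ord0] (cc k) (ww len k) (fun m => (a ord0 m)%:C - (- cc k) * ext m).
Proof.
move=> k0; have -> : Weyl len (k ^+ 2)%:C = Weyl len (k ^+ 2)%:C - kappa (0 : 'rV[R]_n.+1).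
  by rewrite kappa0 subr0.
rewrite Weyl_lap // lap_adjoint.
have conjE m : (((0 : 'rV[R]_n.+1) ord0 m)%:C - cc k * ext m)^* =
    ((0 : 'rV[R]_n.+1) ord0 m)%:C - (- cc k) * ext m.
  by rewrite mxE; case: (external G m); apply/eqP; rewrite eq_complex /=;
    apply/andP; split; apply/eqP; ring.
rewrite (eq_lap _ _ (frefl _) conjE) !lap_add_diag addrAC; congr (_ + _).
by rewrite -(Weyl_int_lap len k%:C 0) -Weyl_int_lap kappa0 subr0.
Qed.

Lemma P_ext_idem : P_ext G *m P_ext G = P_ext G :> 'M[R[i]]_n.+1.
Proof.
rewrite /P_ext mulmx_diag; congr diag_mx; apply/rowP => i; rewrite !mxE.
by case: (external G i); rewrite ?mulr1 ?mulr0.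
Qed.

Lemma P_ext_corner (A : 'M[R[i]]_n.+1) : external G ord0 ->
  (P_ext G *m A *m P_ext G) ord0 ord0 = A ord0 ord0.
Proof. by move=> h0; rewrite mul_mx_diag mxE mul_diag_mx !mxE h0 mul1r mulr1. Qed.

(* Both factors of the scattering matrix are of the form 1 + const P (...) P, and
   the second one does not depend on the coupling constants. *)
Lemma scattering_determines_inverse (N : nat) (F : fieldType) (P A A' B : 'M[F]_N.+1) (c : F) :
  c != 0 -> P *m P = P -> A \in unitmx -> A' \in unitmx -> B \in unitmx ->
  B + c *: P \in unitmx ->
  P *m invmx A *m (A - c *: P) *m invmx B *m (B + c *: P) *m P =
  P *m invmx A' *m (A' - c *: P) *m invmx B *m (B + c *: P) *m P ->
  P *m invmx A *m P = P *m invmx A' *m P.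
Proof.
move=> c0 PP uA uA' uB uB'.
have lhs (X : 'M[F]_N.+1) : X \in unitmx ->
    P *m invmx X *m (X - c *: P) *m invmx B *m (B + c *: P) *m P =
    (P - c *: (P *m invmx X *m P)) *m (invmx B *m (B + c *: P) *m P).
  move=> uX; rewrite !mulmxA; congr (_ *m _ *m _ *m _).
  by rewrite mulmxBr mulmxKV // -scalemxAr.
rewrite !lhs // => /eqP; rewrite -subr_eq0 -mulmxBl opprB addrC addrA subrK -scalerBr.
set Z := _ - _ => hZ; apply/eqP; rewrite eq_sym -subr_eq0 -/Z.
have ZP : Z *m P = Z by rewrite /Z mulmxBl -!mulmxA PP.
clearbody Z.
have uM : invmx B *m (B + c *: P) \in unitmx by rewrite unitmx_mul unitmx_inv uB.
have {}hZ : Z *m (invmx B *m (B + c *: P)) *m P = 0.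
  by apply/eqP; rewrite -mulmxA; move: hZ; rewrite -scalemxAl scaler_eq0 (negPf c0).
(* On the range of [1 - P] the second factor is the identity and [Z] vanishes. With [hZ], the
   product of [Z] with an invertible matrix is 0. *)
have hZ' : Z *m (invmx B *m (B + c *: P)) *m (1%:M - P) = 0.
  have -> : invmx B *m (B + c *: P) = 1%:M + c *: (invmx B *m P).
    by rewrite mulmxDr mulVmx // scalemxAr.
  have PP' : P *m (1%:M - P) = 0 by rewrite mulmxBr mulmx1 PP subrr.
  rewrite -mulmxA mulmxDl mul1mx -scalemxAl -mulmxA PP' mulmx0 scaler0 addr0.
  by rewrite mulmxBr mulmx1 ZP subrr.
have : Z *m (invmx B *m (B + c *: P)) = 0.
  by rewrite -[LHS]mulmx1 -(subrK P 1%:M) mulmxDr hZ' hZ addr0.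
by move/(congr1 (mulmx^~ (invmx (invmx B *m (B + c *: P))))); rewrite mulmxK // mul0mx => ->.
Qed.

End Scattering.

Section Defect.
Context {F : comNzRingType} {n : nat}.
Implicit Types (D : ('I_n.+1 -> F) -> F) (x : 'I_n.+1 -> F).

Definition corner_shift x m := x m - (m == ord0)%:R.

(* For D x = det (A - diag x) the last factor vanishes iff the functions
   D / cofactor 0 0 take the same value at x and x'. *)
Definition defect D x x' := D x * D x' * D (fun=> 0)
  * (D x * D (corner_shift x') - D x' * D (corner_shift x)).

End Defect.

Lemma cross_difference (F : fieldType) (x x' u u' : F) : x != 0 -> x' != 0 ->
  (u' - x') / x' = (u - x) / x -> x * u' - x' * u = 0.
Proof.
move=> x0 x'0 /eqP; rewrite eqr_div // => /eqP h.
have -> : x * u' - x' * u = (u' - x') * x - (u - x) * x' by ring.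
by rewrite h subrr.
Qed.

Section ScatteringDefect.
Context {R : realType} {n : nat} {G : graph n.+1}.
Implicit Types (len : cedge G -> R) (a : 'rV[R]_n.+1) (k s : R).
Hypothesis hext : external G ord0.

Local Notation ext m := ((external G m)%:R : R[i]).
Local Notation cc k := ('i * k%:C : R[i]).
Local Notation ww len k := (fun e => cexp (cc k * (len e)%:C)).
Local Notation cplx a := (fun m => (a ord0 m)%:C).

Definition weyl_det (c : R[i]) (y : cedge G -> R[i]) (x : 'I_n.+1 -> R[i]) :=
  \det (lap [:: ord0] c y (fun m => x m - c * ext m)).

Definition cleared_weyl_det (c : R[i]) (y : cedge G -> R[i]) (x : 'I_n.+1 -> R[i]) :=
  \det (cleared_lap [:: ord0] x (fun m => - ext m) c y).

(** One of the first three factors of [defect] is 0 if [M - kappa], for either set of constants, or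
    [M] itself is singular. Otherwise [M - M^* = 2 i k P_ext] brings the scattering matrices into
    the form of [scattering_determines_inverse], and the corner entries of the two inverses
    agree. *)
Lemma scattering_defect len a a' k : 0 < k ->
  scattering len a' (k ^+ 2) = scattering len a (k ^+ 2) ->
  defect (weyl_det (cc k) (ww len k)) (cplx a) (cplx a') = 0.
Proof.
move=> k0 hS; pose D := weyl_det (cc k) (ww len k).
have DE x : D x = \det (lap [:: ord0] (cc k) (ww len k) (fun m => x m - cc k * ext m)) by [].
rewrite -/D /defect; clearbody D.
have [->|nA] := eqVneq (D (cplx a)) 0; first by rewrite !mul0r.
have [->|nA'] := eqVneq (D (cplx a')) 0; first by rewrite mulr0 !mul0r.
have [->|nB] := eqVneq (D (fun=> 0)) 0; first by rewrite mulr0 mul0r.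
have [L LW LE] : exists2 L : 'rV[R]_n.+1 -> 'M[R[i]]_n.+1,
    forall a0, Weyl len (k ^+ 2)%:C - kappa a0 = L a0 &
    forall a0, L a0 = lap [:: ord0] (cc k) (ww len k) (fun m => (a0 ord0 m)%:C - cc k * ext m).
  exists (fun a0 => Weyl len (k ^+ 2)%:C - kappa a0) => a0; first by [].
  exact: (Weyl_lap len a0 k0).
have AdE a0 : (Weyl len (k ^+ 2)%:C) ^t* - kappa a0 = L a0 - (2 * cc k) *: P_ext G.
  rewrite (Weyl_adjoint _ _ k0) LE (lap_add_diag _ _ (cplx a0) (cc k)).
  rewrite (lap_add_diag _ _ (cplx a0) (- cc k)).
  move: (lap _ _ _ _) => X; move: (cc k) => c; rewrite -[RHS]addrA -scalerBl.
  by congr (X + _ *: _); ring.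
have L0 : L 0 = Weyl len (k ^+ 2)%:C by rewrite -LW kappa0 subr0.
have ME : Weyl len (k ^+ 2)%:C = (Weyl len (k ^+ 2)%:C) ^t* + (2 * cc k) *: P_ext G.
  by have := AdE 0; rewrite kappa0 subr0 L0 => ->; rewrite subrK.
have unitL a0 : D (cplx a0) != 0 -> L a0 \in unitmx.
  by rewrite unitmxE unitfE LE DE.
have uM : Weyl len (k ^+ 2)%:C \in unitmx.
  have cplx0 : cplx (0 : 'rV[R]_n.+1) = fun=> 0 by apply/funext => m; rewrite mxE.
  by rewrite -L0; apply: unitL; rewrite cplx0.
have uMd : (Weyl len (k ^+ 2)%:C) ^t* \in unitmx by rewrite map_unitmx unitmx_tr.
have c0 : 2 * cc k != 0.
  apply: mulf_neq0; first by rewrite pnatr_eq0.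
  apply: mulf_neq0; first exact: imag_neq0.
  by rewrite (fmorph_eq0 (real_complex R)) gt_eqF.
have hI : P_ext G *m invmx (L a') *m P_ext G = P_ext G *m invmx (L a) *m P_ext G.
  move: hS; rewrite /scattering !LW !AdE => hS.
  have := scattering_determines_inverse c0 P_ext_idem (unitL _ nA') (unitL _ nA) uMd.
  move: ME uM uMd hS; move: ((Weyl _ _) ^t*) => Wd.
  move: (Weyl _ _) => W ME uM uMd hS h.
  apply: h; last by rewrite -ME.
  by rewrite -ME.
have cofL a0 : cofactor (L a0) ord0 ord0 = D (corner_shift (cplx a0)) - D (cplx a0).
  rewrite LE lap_cofactor; last by rewrite inE.
  rewrite !DE; have -> : lap [:: ord0] (cc k) (ww len k)
      (fun m => (a0 ord0 m)%:C - cc k * ext m - (m == ord0)%:R) =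
    lap [:: ord0] (cc k) (ww len k) (fun m => corner_shift (cplx a0) m - cc k * ext m).
    by apply: eq_lap => m; [|rewrite /corner_shift addrAC].
  by [].
have detL a0 : \det (L a0) = D (cplx a0) by rewrite LE DE.
have inv0 a0 : D (cplx a0) != 0 -> invmx (L a0) ord0 ord0 =
    (D (corner_shift (cplx a0)) - D (cplx a0)) / D (cplx a0).
  by move=> h; rewrite (invmx_corner (unitL _ h)) cofL detL.
have := congr1 (fun X : 'M[R[i]]_n.+1 => X ord0 ord0) hI.
rewrite !(P_ext_corner _ hext) (inv0 _ nA') (inv0 _ nA).
by move=> /(cross_difference nA nA') ->; rewrite mulr0.
Qed.

End ScatteringDefect.

(** * Continuation to free lengths and contraction *)

Section Continuation.
Context {R : realType}.

Lemma cvg_exprn {K : numFieldType} {T : Type} {F : set_system T} {FF : Filter F}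
    (f : T -> K) (l : K) m : f t @[t --> F] --> l -> f t ^+ m @[t --> F] --> l ^+ m.
Proof.
move=> hf; elim: m => [|m IH]; first by under eq_fun do rewrite expr0; apply: cvg_cst.
by rewrite exprS; under eq_fun do rewrite exprS; apply: cvgM.
Qed.

Lemma cvg_expoly {K : numFieldType} {X : finType} {T : Type} {F : set_system T}
    {FF : Filter F} (f : K -> (X -> K) -> K) (u : T -> K) (v : T -> X -> K) (c : K) (y : X -> K) :
  expoly f -> u t @[t --> F] --> c -> (forall e, v t e @[t --> F] --> y e) ->
  f (u t) (v t) @[t --> F] --> f c y.
Proof.
move=> [s hs] hu hv; rewrite hs; under eq_fun do rewrite hs.
apply: cvg_sums => t _; apply: cvgM.
  rewrite horner_coef; under eq_fun do rewrite horner_coef.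
  by apply: cvg_sums => i _; apply: cvgM; [exact: cvg_cst | exact: cvg_exprn].
by apply: cvg_prods => e; apply: cvg_exprn.
Qed.

(** A continuous function that is nonzero at a point is nonzero on an interval, which a null set
    cannot contain. *)
Lemma ae_eq0_pos (K : numFieldType) (f : R -> K) :
  (forall s : R, f t @[t --> s] --> f s) ->
  {ae (@lebesgue_measure R), forall s : R, 0 < s -> f s = 0} ->
  forall s : R, 0 < s -> f s = 0.
Proof.
move=> hf [N [mN N0 hN]] s s0; apply/eqP; apply: contraT => fs.
have hn : \forall t \near s, f t != 0 by apply: cvgr_neq0 (hf s) fs.
have /nbhs_ballP[r /= r0 hr] : nbhs s [set t | f t != 0 /\ 0 < t]%classic.
  by near=> t; split; near: t => //; exact: lt_nbhsr.
pose J : set R := `]s - r, s + r[%classic.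
have sub : (J `<=` N)%classic.
  move=> t; rewrite /J /= in_itv /= => ht; apply: hN => /= h.
  have [ft t0] : [set t | f t != 0 /\ 0 < t]%classic t.
    by apply: hr; rewrite /ball /= ltr_distlC.
  by move: ft; rewrite h // eqxx.
have : (lebesgue_measure J <= lebesgue_measure N)%E.
  by apply: le_measure; [rewrite inE; exact: measurable_itv | rewrite inE; exact: mN | exact: sub].
rewrite N0 /J lebesgue_measure_itv /= lte_fin ifT; last by lra.
by rewrite -EFinB lee_fin => h; exfalso; move: h; apply/negP; rewrite -ltNge; lra.
Unshelve. all: by end_near. Qed.

End Continuation.

Section DefectVanishes.
Context {R : realType} {n : nat} {G : graph n.+1}.
Implicit Types (len : cedge G -> R) (a : 'rV[R]_n.+1) (k s tau : R) (p : seq (cedge G * bool)).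
Implicit Types (c : R[i]) (y : cedge G -> R[i]).

Local Notation ext m := ((external G m)%:R : R[i]).
Local Notation cc k := ('i * k%:C : R[i]).
Local Notation ww len k := (fun e => cexp (cc k * (len e)%:C)).
Local Notation cplx a := (fun m => (a ord0 m)%:C).

Lemma eq_defect (F : comNzRingType) (D D' : ('I_n.+1 -> F) -> F) x x' :
  D =1 D' -> defect D x x' = defect D' x x'.
Proof. by move=> h; rewrite /defect !h. Qed.

(** Each term is a product of five values of [D]; cleared denominators and the factors from
    contractions can therefore be pulled out. *)
Lemma defect_scale (F : comNzRingType) d (D : ('I_n.+1 -> F) -> F) x x' :
  defect (fun z => d * D z) x x' = d ^+ 5 * defect D x x'.
Proof.
rewrite /defect; move: (D x) (D x') (D _) (D (corner_shift x)) (D (corner_shift x')).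
by move=> ? ? ? ? ?; ring.
Qed.

Lemma cleared_weyl_detE c y x : lap_den y != 0 ->
  cleared_weyl_det c y x = lap_den y ^+ n.+1 * weyl_det c y x.
Proof.
move=> hd; rewrite /weyl_det.
have <- : lap [:: ord0] c y (fun m => x m + c * - ext m) =
    lap [:: ord0] c y (fun m => x m - c * ext m).
  by apply: eq_lap => m; [|rewrite mulrN].
exact: det_cleared_lap.
Qed.

(** The last factor makes the function vanish also where some [y e ^+ 2 = 1], that is where a sine
    is 0 and the cleared matrix is no longer tied to [lap]. *)
Lemma expoly_cleared_defect (x x' : 'I_n.+1 -> R[i]) :
  expoly (fun c y => defect (@cleared_weyl_det R n G c y) x x' * lap_den y).
Proof.
have h z : expoly (fun c y => @cleared_weyl_det R n G c y z).
  exact: expoly_det_cleared_lap.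
apply: expolyM expoly_lap_den; apply: expolyM.
  by apply: expolyM; [apply: expolyM|].
by apply: expolyB; apply: expolyM.
Qed.

Lemma cvg_cexp_imag (f : R -> R) (l : R) {T : set_system R} {FT : Filter T} :
  f t @[t --> T] --> l ->
  (cexp (cc (f t)) : R[i]^o) @[t --> T] --> (cexp (cc l) : R[i]^o).
Proof.
move=> hf; have E x : cexp (cc x) = (cos x)%:C + 'i * (sin x)%:C.
  rewrite cexp_imag; apply/eqP; rewrite eq_complex /=.
  by apply/andP; split; apply/eqP; ring.
rewrite E; under eq_fun do rewrite E.
have hC (g : R -> R) : continuous g ->
    ((g (f t))%:C : R[i]^o) @[t --> T] --> ((g l)%:C : R[i]^o).
  move=> hg; apply: (@cvg_comp _ _ _ (fun t => g (f t))
    (fun x : R => x%:C : R[i]^o) _ (nbhs (g l))).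
    by apply: continuous_cvg => //; exact: hg.
  exact: real_complex_continuous.
apply: cvgD; first by apply: hC; exact: continuous_cos.
by apply: cvgMr; apply: hC; exact: continuous_sin.
Qed.

Lemma cleared_defect_at len a a' k : external G ord0 -> 0 < k ->
  scattering len a' (k ^+ 2) = scattering len a (k ^+ 2) ->
  defect (cleared_weyl_det (cc k) (ww len k)) (cplx a) (cplx a')
    * lap_den (ww len k) = 0.
Proof.
move=> hext k0 hS; have [->|hd] := eqVneq (lap_den (ww len k)) 0; first by rewrite mulr0.
rewrite (eq_defect _ _ (fun x => cleared_weyl_detE (cc k) x hd)) defect_scale.
by rewrite (scattering_defect hext k0 hS) mulr0 mul0r.
Qed.

Lemma weyl_defect_eq0 len a a' : external G ord0 -> rationally_independent len ->
  {ae (@lebesgue_measure R), forall s : R, 0 < s ->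
     scattering len a' s = scattering len a s} ->
  forall c y, lap_den y != 0 -> defect (weyl_det c y) (cplx a) (cplx a') = 0.
Proof.
move=> hext hrat hae c y hd.
have sqr s : 0 < s -> s = Num.sqrt s ^+ 2 by move=> s0; rewrite sqr_sqrtr // ltW.
pose f c y := defect (@cleared_weyl_det R n G c y) (cplx a) (cplx a') * lap_den y.
have fE : f c y = 0.
  apply: (expoly_eq0 hrat (expoly_cleared_defect _ _)) => k k0.
  pose g s := f (cc (Num.sqrt s)) (ww len (Num.sqrt s)).
  have g0 : forall s, 0 < s -> g s = 0.
    apply: ae_eq0_pos => [s|].
      apply: cvg_expoly; first exact: expoly_cleared_defect.
        apply: cvgMr; apply: (@cvg_comp _ _ _ (@Num.sqrt R)
          (fun x : R => x%:C : R[i]^o) _ (nbhs (Num.sqrt s))).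
          exact: sqrt_continuous.
        exact: real_complex_continuous.
      move=> e; under eq_fun do rewrite -mulrA -rmorphM.
      rewrite -mulrA -rmorphM; apply: (@cvg_cexp_imag (fun t => Num.sqrt t * len e)).
      by apply: cvgMl; exact: sqrt_continuous.
    case: hae => N [mN N0 hN]; exists N; split=> // s /= ngs; apply: hN => /= hs.
    apply: ngs => s0; apply: (cleared_defect_at hext); first by rewrite sqrtr_gt0.
    by rewrite -(sqr s s0); apply: hs.
  have := g0 (k ^+ 2) (exprn_gt0 _ k0); rewrite /g sqrtr_sqr gtr0_norm //.
have nz : (lap_den y ^+ n.+1) ^+ 5 != 0 by rewrite !expf_neq0.
apply: (mulIf hd); apply: (mulfI nz).
rewrite mul0r mulr0 mulrA -defect_scale -[RHS]fE; congr (_ * _).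
by apply: eq_defect => x; rewrite cleared_weyl_detE.
Qed.

Definition path_det p len tau (x : 'I_n.+1 -> R) : R :=
  \det (path_lap p len (fun m => x m + tau * (external G m)%:R) tau).

Lemma path_det0E len tau x :
  weyl_det (- tau)%:C (fun e => (expR (- (tau * len e)))%:C) (fun m => (x m)%:C) =
  (path_det [::] len tau x)%:C.
Proof.
rewrite /weyl_det /path_det -(det_map_mx (real_complex R)) /path_lap map_lap.
congr (\det _); apply: eq_lap => m; first by [].
by rewrite /= rmorphD rmorphM rmorph_nat rmorphN mulNr opprK.
Qed.

Lemma path_defect0 len a a' tau : 0 < tau -> (forall e, 0 < len e) ->
  (forall c y, lap_den y != 0 -> defect (@weyl_det R n G c y) (cplx a) (cplx a') = 0) ->
  defect (path_det [::] len tau) (a ord0) (a' ord0) = 0.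
Proof.
move=> tau0 hlen hW; apply: (@complexI R); rewrite rmorph0.
rewrite -(hW (- tau)%:C (fun e => (expR (- (tau * len e)))%:C)); last first.
  apply/prodf_neq0 => e _; rewrite -rmorphXn -(rmorph1 (real_complex R)) -rmorphB fmorph_eq0.
  rewrite subr_eq0 lt_eqF // expr_lt1 ?expR_ge0 // expR_lt1 oppr_lt0 mulr_gt0 //.
have shiftE x : corner_shift (fun m => (x m)%:C) = fun m => (corner_shift x m)%:C :> R[i].
  by apply/funext => m; rewrite /corner_shift rmorphB rmorph_nat.
have zeroE : (fun=> 0) = (fun m : 'I_n.+1 => (0 : R)%:C) :> ('I_n.+1 -> R[i]) by [].
rewrite /defect !shiftE zeroE !path_det0E.
by rewrite !(rmorphM (real_complex R)) rmorphB !rmorphM.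
Qed.

(** The hypothesis holds for all positive lengths, not only the given ones, so the length of the new
    edge can tend to 0; the scaled determinants converge, and their common factor leaves [defect] as
    [(- 2)^5]. *)
Lemma path_defect_step p d l a a' tau : 0 < tau ->
  walk ord0 (rcons p d) l -> uniq (walk_vertices ord0 (rcons p d)) ->
  (forall len, (forall e, 0 < len e) ->
     defect (path_det p len tau) (a ord0) (a' ord0) = 0) ->
  forall len, (forall e, 0 < len e) ->
    defect (path_det (rcons p d) len tau) (a ord0) (a' ord0) = 0.
Proof.
move=> tau0 hp hu IH len hlen.
pose sc t := expR (- (tau * t)) ^+ 2 - 1.
pose Dt t x := sc t * path_det p [eta len with d.1 |-> t] tau x.
have hD x : Dt t x @[t --> 0^'+] --> - 2 * path_det (rcons p d) len tau x.
  exact: (@cvg_det_path_lap _ _ _ p d l hp hu len _ tau tau0).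
have hdef : defect (Dt t) (a ord0) (a' ord0) @[t --> 0^'+] -->
    defect (fun x => - 2 * path_det (rcons p d) len tau x) (a ord0) (a' ord0).
  apply: cvgM; first by apply: cvgM; [apply: cvgM|]; apply: hD.
  by apply: cvgB; apply: cvgM; apply: hD.
have h0 : defect (Dt t) (a ord0) (a' ord0) @[t --> 0^'+] --> (0 : R).
  apply: (cvg_trans (near_eq_cvg (f := fun=> 0) _) (cvg_cst _)).
  near=> t; rewrite /Dt defect_scale IH ?mulr0 // => e /=.
  by case: eqP => // _; near: t; exact: nbhs_right_gt.
have /eqP : defect (fun x => - 2 * path_det (rcons p d) len tau x) (a ord0) (a' ord0) = 0.
  exact: norm_cvg_unique hdef h0.
rewrite defect_scale.
by rewrite mulf_eq0 expf_eq0 /= oppr_eq0 pnatr_eq0 /= => /eqP.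
Unshelve. all: by end_near. Qed.

Lemma path_defect_eq0 p l len a a' tau : 0 < tau -> walk ord0 p l ->
  uniq (walk_vertices ord0 p) -> (forall e, 0 < len e) ->
  (forall c y, lap_den y != 0 -> defect (@weyl_det R n G c y) (cplx a) (cplx a') = 0) ->
  defect (path_det p len tau) (a ord0) (a' ord0) = 0.
Proof.
move=> tau0 + + + hW; elim/last_ind: p l len => [|p d IH] l len hp hu hlen.
  exact: path_defect0.
apply: (path_defect_step tau0 hp hu) => // len' hlen'.
move: hp hu; rewrite walk_rcons walk_vertices_rcons rcons_uniq => /andP[hp _] /andP[_ hu].
exact: IH hp hu hlen'.
Qed.

(** For large [tau] the determinants and cofactors are nonzero, so the vanishing of [defect] equates
    the two quotients [det / cofactor]. Their terms linear in [tau] depend only on the graph and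
    agree; what remains tends to the negatives of the path sums. *)
Lemma path_sum_eq p l len a a' : external G ord0 -> connected_graph G ->
  (forall e, 0 < len e) -> walk ord0 p l -> uniq (walk_vertices ord0 p) ->
  (forall c y, lap_den y != 0 -> defect (@weyl_det R n G c y) (cplx a) (cplx a') = 0) ->
  \sum_(m | m \in walk_vertices ord0 p) a' ord0 m =
  \sum_(m | m \in walk_vertices ord0 p) a ord0 m.
Proof.
move=> hext hconn hlen hp hu hW.
pose w m : R := (external G m)%:R.
have w0 m : 0 <= w m by rewrite ler0n.
have wr : 0 < w ord0 by rewrite /w hext ltr01.
have cofE x tau : cofactor (path_lap p len (fun m => x m + tau * w m) tau) ord0 ord0 =
    path_det p len tau (corner_shift x) - path_det p len tau x.
  rewrite /path_lap lap_cofactor; last by rewrite inE eqxx.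
  congr (\det _ - _); apply: eq_lap => m; first by [].
  by rewrite /corner_shift addrAC.
have cof0 x := @path_lap_cofactor_neq0 _ _ _ p len x w hlen w0 hconn l hp.
have det0 x := @path_lap_det_neq0 _ _ _ p len x w hlen w0 hconn l hp wr.
have lim x := @cvg_Schur _ _ _ p len x w hlen w0 hconn l hp.
apply: oppr_inj; apply: (norm_cvg_unique (lim (a' ord0))).
apply: cvg_trans (lim (a ord0)); apply: near_eq_cvg; near=> tau.
have tau0 : 0 < tau by near: tau; apply: nbhs_pinfty_gt; rewrite num_real.
have := path_defect_eq0 tau0 hp hu hlen hW.
have nA : path_det p len tau (a ord0) != 0 by near: tau; apply: det0.
have nA' : path_det p len tau (a' ord0) != 0 by near: tau; apply: det0.
have n0 : path_det p len tau (fun=> 0) != 0 by near: tau; apply: det0.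
have cA : cofactor (path_lap p len (fun m => a ord0 m + tau * w m) tau) ord0 ord0 != 0.
  by near: tau; apply: cof0.
have cA' : cofactor (path_lap p len (fun m => a' ord0 m + tau * w m) tau) ord0 ord0 != 0.
  by near: tau; apply: cof0.
rewrite /defect => /eqP; rewrite !mulf_eq0 (negPf nA) (negPf nA') (negPf n0) /= subr_eq0 => /eqP h.
congr (_ + _); rewrite -/(path_det p len tau (a ord0)) -/(path_det p len tau (a' ord0)).
rewrite !cofE in cA cA' *.
by apply/eqP; rewrite eqr_div // !mulrBr h; apply/eqP; ring.
Unshelve. all: by end_near. Qed.

End DefectVanishes.

Theorem theorem8p3 (R : realType) (n : nat) (G : graph n.+1)
    (len : cedge G -> R) (a : 'rV[R]_n.+1)
    (T : {set cedge G}) (gamma : 'I_n.+1 -> seq (cedge G * bool))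
    (hV : nonempty_vertices G)
    (hlen : forall e, 0 < len e)
    (hhalf : injective (@hend n.+1 G))
    (hconn : connected_graph G)
    (hrat : rationally_independent len)
    (hext : external G ord0)
    (hT : spanning_tree T)
    (hgamma : forall m, simple_path_in T ord0 (gamma m) m)
    (hnum : forall m m' : 'I_n.+1,
        (m <= m')%N -> (size (gamma m) <= size (gamma m'))%N) :
  (forall a' : 'rV[R]_n.+1,
      {ae (@lebesgue_measure R), forall s : R, 0 < s ->
         scattering len a' s = scattering len a s} ->
      (forall z phi psi, Robin_to_Dirichlet len a' z phi psi <->
                         Robin_to_Dirichlet len a z phi psi)
      /\ kappa a' = kappa a)
  /\ (forall z phi psi, regular_point len a z ->
        (Robin_to_Dirichlet len a z phi psi <->
         P_ext G *m phi = phi /\ psi = Robin_to_Dirichlet_mx len a z *m phi))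
  /\ (forall l : 'I_n.+1,
        path_formula a len (gamma l)
          (\sum_(m | m \in walk_vertices ord0 (gamma l)) a ord0 m))
  /\ (forall b : 'rV[R]_n.+1,
        (forall l : 'I_n.+1,
           \sum_(m | m \in walk_vertices ord0 (gamma l)) b ord0 m =
           \sum_(m | m \in walk_vertices ord0 (gamma l)) a ord0 m) ->
        b = a).
Proof.
have row_inj (b : 'rV[R]_n.+1) : (forall l : 'I_n.+1,
    \sum_(m | m \in walk_vertices ord0 (gamma l)) b ord0 m =
    \sum_(m | m \in walk_vertices ord0 (gamma l)) a ord0 m) -> b = a.
  by move=> hb; apply/rowP; apply: (path_sums_injective hT hgamma hb).
split.
  move=> a' hae; suff -> : a' = a by split.
  apply: row_inj => l; have [[hw _] hu] := hgamma l.
  exact: (path_sum_eq hext hconn hlen hw hu (weyl_defect_eq0 hext hrat hae)).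
split; first by move=> z phi psi; apply: Robin_to_DirichletE.
split=> [l|b]; last exact: row_inj.
by have [[hw _] hu] := hgamma l; apply: path_formulaP hw hu.
Qed.
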